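(* Let $R$ be a commutative noetherian ring with unity, let $\mathfrak{a}$ be an ideal of $R$ and let $M$ be an $R$-module. Then the following assertions are equivalent: (i) $H^{\mathfrak{a}}_{i}(M)$ is a finitely generated $\widehat{R}^{\mathfrak{a}}$-module for every $i\geq 0$. (ii) $\operatorname{Tor}^{R}_{i}(R/\mathfrak{a},M)$ is a finitely generated $R$-module for every $i\geq 0$. (iii) $\operatorname{Tor}^{R}_{i}(R/\mathfrak{a},M)$ is a finitely generated $R$-module for every $0\leq i\leq \operatorname{hd}(\mathfrak{a},M)$.
   Context: For an $R$-module $M$, let $\Lambda^{\mathfrak{a}}(M):=\widehat{M}^{\mathfrak{a}}=\varprojlim_n (M/\mathfrak{a}^{n}M)$, and for an $R$-homomorphism $f$ let $\Lambda^{\mathfrak{a}}(f):=\widehat{f}$; this is the $\mathfrak{a}$-adic completion functor on $R$-modules. The $i$th local homology module of $M$ with respect to $\mathfrak{a}$ is $H^{\mathfrak{a}}_{i}(M):=H_{i}(\Lambda^{\mathfrak{a}}(P))$ for $i\geq 0$, where $P$ is any projective resolution of $M$; i.e. $H^{\mathfrak{a}}_i$ is the $i$th left derived functor of $\Lambda^{\mathfrak{a}}$. It is naturally a module over the completion $\widehat{R}^{\mathfrak{a}}$. The homological dimension of $M$ with respect to $\mathfrak{a}$ is $\operatorname{hd}(\mathfrak{a},M):=\sup\{i\geq 0 \mid H^{\mathfrak{a}}_{i}(M)\neq 0\}$ (with the usual convention $\sup\emptyset=-\infty$). *)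

(* Defs.v *)
From HB Require Import structures.
From mathcomp Require Import all_boot all_order all_algebra.
From mathcomp Require Import finmap.
From mathcomp Require Import boolp classical_sets functions cardinality fsbigop.
From mathcomp Require Import constructive_ereal.

Set Implicit Arguments.
Unset Strict Implicit.
Unset Printing Implicit Defensive.

Import Order.TTheory GRing.Theory Num.Theory.
Local Open Scope classical_set_scope.
Local Open Scope ring_scope.
Local Open Scope quotient_scope.

(* Modules are left modules over possibly trivial rings; triviality has to be
   allowed because the completion ring is zero when the ideal is the whole
   ring. A submodule is a [submodClosed] boolean predicate, the boolean being
   the classical truth value [`[< _ >]] of the defining property. *)

Section Submodules.
Variables (R : pzRingType) (V : lmodType R).

Lemma submod0 (S : submodClosed V) : 0 \in S.
Proof. by case: (submodClosedP S). Qed.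

Lemma submodP (S : submodClosed V) (c : R) (x y : V) :
  x \in S -> y \in S -> c *: x + y \in S.
Proof. by case: (submodClosedP S) => _; apply. Qed.

Lemma submodB (S : submodClosed V) (x y : V) :
  x \in S -> y \in S -> x - y \in S.
Proof. by move=> xS yS; rewrite addrC -scaleN1r submodP. Qed.

Record submod (S : submodClosed V) := Submod {
  submod_val : V;
  submod_valP : submod_val \in S }.

Section SubmodInstances.
Variable S : submodClosed V.
HB.instance Definition _ := [isSub for @submod_val S].
HB.instance Definition _ := [Choice of submod S by <:].
HB.instance Definition _ := [SubChoice_isSubLmodule of submod S by <:].
End SubmodInstances.

Definition full_submod : {pred V} := fun=> true.
Fact full_submod_closed : submod_closed full_submod. Proof. by []. Qed.
HB.instance Definition _ :=
  GRing.isSubmodClosed.Build R V full_submod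
    (GRing.submod_closed_semi full_submod_closed).

Definition span (E : set V) : {pred V} := fun v => `[<
  exists s : seq (R * V), (forall p, p \in s -> E p.2) /\
    v = \sum_(p <- s) p.1 *: p.2 >].


Fact span_closed (E : set V) : submod_closed (span E).
Proof.
split=> [|c x y /asboolP[s [Es ->]] /asboolP[t [Et ->]]]; apply/asboolP.
  by exists [::]; rewrite big_nil.
exists ([seq (c * p.1, p.2) | p <- s] ++ t); split=> [p|].
  by rewrite mem_cat => /orP[/mapP[q /Es Eq ->]|/Et].
rewrite big_cat big_map scaler_sumr; congr (_ + _).
by apply: eq_bigr => p _; rewrite scalerA.
Qed.
HB.instance Definition _ (E : set V) :=
  GRing.isSubmodClosed.Build R V (span E)
    (GRing.submod_closed_semi (span_closed E)).

Lemma span_min (E : set V) (S : submodClosed V) :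
  (forall x, E x -> x \in S) -> forall x, x \in span E -> x \in S.
Proof.
move=> ES x /asboolP[s [Es ->]]; elim: s Es => [|p s IH] Es.
  by rewrite big_nil submod0.
rewrite big_cons; apply: submodP; first by apply/ES/Es/mem_head.
by apply: IH => q qs; apply: Es; rewrite inE qs orbT.
Qed.

Lemma mem_span (E : set V) x : E x -> x \in span E.
Proof.
move=> Ex; apply/asboolP; exists [:: (1, x)]; split=> [p|].
  by rewrite inE => /eqP->.
by rewrite big_seq1 scale1r.
Qed.

End Submodules.

Arguments full_submod {R} V.

Section Quotients.
Variables (R : pzRingType) (V : lmodType R) (S : submodClosed V).

Definition mod_eq (x y : V) := x - y \in S.
Fact mod_eq_refl : reflexive mod_eq.
Proof. by move=> x; rewrite /mod_eq subrr submod0. Qed.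
Fact mod_eq_sym : symmetric mod_eq.
Proof.
suff H x y : mod_eq x y -> mod_eq y x by move=> x y; apply/idP/idP; apply: H.
by move=> /(submodB (submod0 S)); rewrite sub0r opprB.
Qed.
Fact mod_eq_trans : transitive mod_eq.
Proof.
move=> y x z xy yz; rewrite /mod_eq -(subrK y x) -addrA -[x - y]scale1r.
exact: submodP.
Qed.
Canonical mod_equiv := EquivRel mod_eq mod_eq_refl mod_eq_sym mod_eq_trans.

Definition quotm := {eq_quot mod_equiv}.
HB.instance Definition _ := Choice.on quotm.

Definition quot_proj (x : V) : quotm := \pi_quotm x.

Lemma quot_projP x y : quot_proj x = quot_proj y <-> x - y \in S.
Proof. by split=> [/eqquotP|H]; [|apply/eqquotP]. Qed.

Lemma quot_reprK (x : quotm) : quot_proj (repr x) = x.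
Proof. exact: reprK. Qed.

Lemma quot_reprP x : repr (quot_proj x) - x \in S.
Proof. by apply/quot_projP; rewrite quot_reprK. Qed.

Definition quot_add (x y : quotm) := quot_proj (repr x + repr y).
Definition quot_opp (x : quotm) := quot_proj (- repr x).
Definition quot_scale (c : R) (x : quotm) := quot_proj (c *: repr x).

Fact quot_addE x y :
  quot_add (quot_proj x) (quot_proj y) = quot_proj (x + y).
Proof.
apply/quot_projP; rewrite opprD addrACA -[_ - x]scale1r.
by rewrite submodP ?quot_reprP.
Qed.
Fact quot_oppE x : quot_opp (quot_proj x) = quot_proj (- x).
Proof.
apply/quot_projP; rewrite -opprD -sub0r.
by rewrite submodB ?submod0 ?quot_reprP.
Qed.
Fact quot_scaleE c x : quot_scale c (quot_proj x) = quot_proj (c *: x).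
Proof.
apply/quot_projP; rewrite -scalerBr -[_ *: _]addr0.
by rewrite submodP ?submod0 ?quot_reprP.
Qed.

Fact quot_addA : associative quot_add.
Proof.
move=> x y z; rewrite -[x]quot_reprK -[y]quot_reprK -[z]quot_reprK.
by rewrite !quot_addE addrA.
Qed.
Fact quot_addC : commutative quot_add.
Proof. by move=> x y; rewrite /quot_add addrC. Qed.
Fact quot_add0 : left_id (quot_proj 0) quot_add.
Proof. by move=> x; rewrite -[x]quot_reprK quot_addE add0r. Qed.
Fact quot_addN : left_inverse (quot_proj 0) quot_opp quot_add.
Proof. by move=> x; rewrite -[x]quot_reprK quot_oppE quot_addE addNr. Qed.
HB.instance Definition _ :=
  GRing.isZmodule.Build quotm quot_addA quot_addC quot_add0 quot_addN.

Fact quot_scaleA a b x :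
  quot_scale a (quot_scale b x) = quot_scale (a * b) x.
Proof. by rewrite -[x]quot_reprK !quot_scaleE scalerA. Qed.
Fact quot_scale1 : left_id 1 quot_scale.
Proof. by move=> x; rewrite -[x]quot_reprK quot_scaleE scale1r. Qed.
Fact quot_scaleDr : right_distributive quot_scale +%R.
Proof.
move=> a x y; rewrite -[x]quot_reprK -[y]quot_reprK.
by rewrite [X in quot_scale _ X]quot_addE !quot_scaleE scalerDr -quot_addE.
Qed.
Fact quot_scaleDl x : {morph quot_scale^~ x : a b / a + b}.
Proof.
by move=> a b; rewrite -[x]quot_reprK !quot_scaleE scalerDl -quot_addE.
Qed.
HB.instance Definition _ := GRing.Zmodule_isLmodule.Build R quotm
  quot_scaleA quot_scale1 quot_scaleDr quot_scaleDl.

Fact quot_proj_linear : linear quot_proj.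
Proof. by move=> c x y; rewrite -quot_addE -quot_scaleE. Qed.
HB.instance Definition _ :=
  GRing.isLinear.Build R V quotm *:%R quot_proj quot_proj_linear.

End Quotients.

(* Only meaningful when [f] maps [S] into [T], see [quot_mapE]. *)
Definition quot_map (R : pzRingType) (V W : lmodType R) (S : submodClosed V)
    (T : submodClosed W) (f : {linear V -> W}) (x : quotm S) : quotm T :=
  quot_proj T (f (repr x)).

Section QuotMap.
Variables (R : pzRingType) (V W : lmodType R) (S : submodClosed V).
Variables (T : submodClosed W) (f : {linear V -> W}).
Hypothesis fST : forall x, x \in S -> f x \in T.

Lemma quot_mapE x : quot_map T f (quot_proj S x) = quot_proj T (f x).
Proof. by apply/quot_projP; rewrite -linearB fST ?quot_reprP. Qed.

Lemma quot_map_linear : linear (quot_map (S := S) T f).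
Proof.
move=> c x y; rewrite -[x]quot_reprK -[y]quot_reprK -linearP !quot_mapE.
by rewrite !linearP.
Qed.
End QuotMap.

Section FreeModule.
Variables (R : pzRingType) (X : choiceType).

Definition fin_supp : {pred (X -> R^o)} :=
  fun f => `[< finite_set [set x | f x != 0] >].
Fact fin_supp_closed : submod_closed fin_supp.
Proof.
split=> [|c f g /asboolP ff /asboolP fg]; apply/asboolP.
  by apply: (sub_finite_set _ (@finite_set0 X)) => x /=; rewrite eqxx.
apply: (@sub_finite_set _ _ ([set x | f x != 0] `|` [set x | g x != 0])).
  move=> x /=; have [fx0|] := eqVneq (f x) 0; last by left.
  have [gx0|] := eqVneq (g x) 0; last by right.
  rewrite [_ x](_ : _ = c *: f x + g x)//.
  by rewrite fx0 gx0 scaler0 addr0 eqxx.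
by rewrite finite_setU.
Qed.
HB.instance Definition _ := GRing.isSubmodClosed.Build R (X -> R^o) fin_supp
  (GRing.submod_closed_semi fin_supp_closed).

(* The free module on [X], as finitely supported functions. *)
Definition freem := submod fin_supp.
HB.instance Definition _ := GRing.Lmodule.on freem.

Fact free_gen_subproof (x : X) : (fun y => (y == x)%:R : R^o) \in fin_supp.
Proof.
apply/asboolP; apply: (sub_finite_set _ (finite_set1 x)) => y /=.
by have [->|] := eqVneq y x; rewrite ?eqxx.
Qed.
Definition free_gen (x : X) : freem := Submod (free_gen_subproof x).

Variables (V : lmodType R) (g : X -> V).

Definition free_lift (f : freem) : V :=
  \sum_(x \in [set: X]) (submod_val f x : R) *: g x.

Lemma free_lift_seq (f : freem) (s : {fset X}) :
  (forall x, x \notin s -> submod_val f x = 0) ->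
  free_lift f = \sum_(x <- s) (submod_val f x : R) *: g x.
Proof. by move=> fs; apply: fsbigTE => x /fs->; rewrite scale0r. Qed.

Fact free_lift_linear : linear free_lift.
Proof.
move=> c f h.
have /asboolP/finite_fsetP[s sE] := submod_valP f.
have /asboolP/finite_fsetP[t tE] := submod_valP h.
have fE x : x \notin (s `|` t)%fset -> submod_val f x = 0.
  rewrite in_fsetU negb_or => /andP[xs _]; apply/eqP; apply: contraNT xs => H.
  by have : [set y | submod_val f y != 0] x := H; rewrite sE.
have hE x : x \notin (s `|` t)%fset -> submod_val h x = 0.
  rewrite in_fsetU negb_or => /andP[_ xs]; apply/eqP; apply: contraNT xs => H.
  by have : [set y | submod_val h y != 0] x := H; rewrite tE.
rewrite (free_lift_seq fE) (free_lift_seq hE) (@free_lift_seq _ (s `|` t)%fset).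
  rewrite scaler_sumr -big_split; apply: eq_bigr => x _ /=.
  by rewrite scalerA -scalerDl.
by move=> x xst; rewrite [LHS](_ : _ = c * submod_val f x + submod_val h x)//
  fE// hE// mulr0 addr0.
Qed.
HB.instance Definition _ :=
  GRing.isLinear.Build R freem V *:%R free_lift free_lift_linear.

Lemma free_lift_gen x : free_lift (free_gen x) = g x.
Proof.
rewrite (@free_lift_seq _ [fset x]%fset) ?big_seq_fset1 /= ?eqxx ?scale1r//.
by move=> y; rewrite in_fset1 /= => /negbTE->.
Qed.

End FreeModule.

Definition projective (R : pzRingType) (P : lmodType R) : Prop :=
  forall (A B : lmodType R) (g : {linear A -> B}) (f : {linear P -> B}),
    (forall b, exists a, g a = b) ->
    exists h : {linear P -> A}, forall x, g (h x) = f x.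

Section FreeExt.
Variables (R : pzRingType) (X : choiceType).

Lemma free_liftK (u : freem R X) : free_lift (@free_gen R X) u = u.
Proof.
have /asboolP/finite_fsetP[t tE] := submod_valP u.
have ut x : x \notin t -> submod_val u x = 0.
  move=> xt; apply/eqP; apply: contraNT xt => H.
  by have : [set y | submod_val u y != 0] x := H; rewrite tE.
apply/esym/val_inj/funext => y; rewrite (free_lift_seq _ ut).
rewrite raddf_sum fct_sumE /=.
have [yt|yt] := boolP (y \in t); last first.
  rewrite ut// big_seq big1// => x xt.
  rewrite [LHS](_ : _ = (submod_val u x : R) * (y == x)%:R)//.
  by case: eqP xt yt => [->->//|]; rewrite mulr0.
rewrite (big_fsetD1 y)//= big_seq big1 ?addr0.
  by rewrite [RHS](_ : _ = (submod_val u y : R) * (y == y)%:R)// eqxx mulr1.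
move=> x; rewrite in_fsetD1 => /andP[xy _].
rewrite [LHS](_ : _ = (submod_val u x : R) * (y == x)%:R)//.
by rewrite eq_sym (negbTE xy) mulr0.
Qed.

Lemma free_ext (W : lmodType R) (f g : {linear freem R X -> W}) :
  (forall x, f (free_gen R x) = g (free_gen R x)) -> f =1 g.
Proof.
move=> fg u; rewrite -[u]free_liftK /free_lift !linear_sum.
by apply: eq_bigr => x _; rewrite !linearZ fg.
Qed.

Lemma free_projective : projective (freem R X).
Proof.
move=> A B g f /choice[s gs].
pose h : {linear freem R X -> A} := free_lift (fun x => s (f (free_gen R x))).
exists h; apply: (free_ext (f := g \o h)) => x /=.
by rewrite free_lift_gen gs.
Qed.

End FreeExt.

Section Complexes.
Variable R : pzRingType.

Record complex := Complex {
  cobj :> nat -> lmodType R;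
  cdiff : forall n, {linear cobj n.+1 -> cobj n};
  cdiffK : forall n x, cdiff n (cdiff n.+1 x) = 0 }.

Definition cycles (C : complex) (n : nat) : {pred C n} :=
  match n return {pred C n} with
  | 0 => fun=> true
  | m.+1 => fun x => cdiff C m x == 0
  end.
Fact cycles_closed C n : submod_closed (@cycles C n).
Proof.
case: n => [|n]; split=> //=; rewrite /in_mem /=; first by rewrite linear0.
move=> c x y; rewrite /in_mem /= => /eqP x0 /eqP y0.
by rewrite linearP x0 y0 scaler0 addr0.
Qed.
HB.instance Definition _ (C : complex) (n : nat) :=
  GRing.isSubmodClosed.Build R (C n) (@cycles C n)
    (GRing.submod_closed_semi (@cycles_closed C n)).

Definition boundaries (C : complex) (n : nat) : {pred submod (@cycles C n)} :=
  fun z => `[< exists y, submod_val z = cdiff C n y >].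
Fact boundaries_closed C n : submod_closed (@boundaries C n).
Proof.
split=> [|c x y /asboolP[x' xE] /asboolP[y' yE]]; apply/asboolP.
  by exists 0; rewrite linear0.
by exists (c *: x' + y'); rewrite linearP -xE -yE.
Qed.
HB.instance Definition _ (C : complex) (n : nat) :=
  GRing.isSubmodClosed.Build R _ (@boundaries C n)
    (GRing.submod_closed_semi (@boundaries_closed C n)).

Definition homology (C : complex) (n : nat) : lmodType R :=
  quotm (@boundaries C n).

Record projective_resolution (M : lmodType R) := ProjectiveResolution {
  res_cplx :> complex;
  res_aug : {linear res_cplx 0 -> M};
  res_proj : forall n, projective (res_cplx n);
  res_surj : forall y, exists x, res_aug x = y;
  res_exact0 : forall x, res_aug x = 0 <-> exists y, x = cdiff res_cplx 0 y;
  res_exact : forall n x,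
    cdiff res_cplx n x = 0 <-> exists y, x = cdiff res_cplx n.+1 y }.

End Complexes.

Section FreeResolution.
Variable R : pzRingType.

Definition lker_pred (A B : lmodType R) (f : {linear A -> B}) : {pred A} :=
  fun x => f x == 0.
Fact lker_closed A B f : submod_closed (@lker_pred A B f).
Proof.
split=> [|c x y]; rewrite /in_mem /= /lker_pred ?linear0// => /eqP x0 /eqP y0.
by rewrite linearP x0 y0 scaler0 addr0.
Qed.
HB.instance Definition _ (A B : lmodType R) (f : {linear A -> B}) :=
  GRing.isSubmodClosed.Build R A (@lker_pred A B f)
    (GRing.submod_closed_semi (@lker_closed A B f)).

Record arrow := Arrow {
  asrc : lmodType R; atgt : lmodType R; amap : {linear asrc -> atgt} }.

(* The free module on the elements of [ker a], mapping onto that kernel;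
   iterating from the free module on the elements of [M] gives a free
   resolution of [M]. *)
Definition cover_ker (a : arrow) : arrow :=
  Arrow (free_lift (fun x : submod (lker_pred (amap a)) => submod_val x)).

Definition free_arrow (M : lmodType R) (n : nat) : arrow :=
  iter n cover_ker (Arrow (free_lift (fun x : M => x))).

Lemma cover_kerP (a : arrow) x :
  amap a x = 0 <-> exists y, x = amap (cover_ker a) y.
Proof.
split=> [/eqP x0|[y ->]].
  by exists (free_gen R (Submod (x0 : x \in lker_pred (amap a))));
    rewrite /= free_lift_gen.
rewrite /= /free_lift linear_sum big1// => z _.
by rewrite linearZ /= (eqP (submod_valP z)) scaler0.
Qed.

Definition free_complex (M : lmodType R) : complex R :=
  @Complex R (fun n => asrc (free_arrow M n))
    (fun n => amap (free_arrow M n.+1))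
    (fun n x => iffRL (@cover_kerP (free_arrow M n.+1) _) (ex_intro _ x erefl)).

Definition free_resolution (M : lmodType R) : projective_resolution M.
Proof.
apply: (@ProjectiveResolution R M (free_complex M) (amap (free_arrow M 0))).
- by case=> [|n]; apply: free_projective.
- by move=> y; exists (free_gen R y); rewrite /= free_lift_gen.
- exact: (@cover_kerP (free_arrow M 0)).
- by move=> n; exact: (@cover_kerP (free_arrow M n.+1)).
Defined.

End FreeResolution.

Lemma linear_eq (R : pzRingType) (A B : lmodType R) (f g : {linear A -> B}) :
  f =1 g -> f = g.
Proof.
case: f g => [f [fa fs]] [g [ga gs]] /= /funext fg.
case: _ / fg in ga gs *; case: fa ga fs gs => [fa] [ga] [fs] [gs].
by rewrite (Prop_irrelevance fa ga) (Prop_irrelevance fs gs).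
Qed.

Record additive_functor (R S : pzRingType) := AdditiveFunctor {
  fobj :> lmodType R -> lmodType S;
  fmap : forall A B : lmodType R, {linear A -> B} -> {linear fobj A -> fobj B};
  fmap_id : forall (A : lmodType R) x, fmap (idfun : {linear A -> A}) x = x;
  fmap_comp : forall (A B C : lmodType R)
      (f : {linear B -> C}) (g : {linear A -> B}) x,
    fmap (f \o g : {linear A -> C}) x = fmap f (fmap g x);
  fmap_add : forall (A B : lmodType R) (f g : {linear A -> B}) x,
    fmap (f \+ g : {linear A -> B}) x = fmap f x + fmap g x }.

Definition mk_linear (R : pzRingType) (A B : lmodType R) (f : A -> B)
    (lf : linear f) : {linear A -> B} :=
  HB.pack f (GRing.isLinear.Build R A B *:%R f lf).

Section ChainMaps.
Variables (R : pzRingType) (C D : complex R).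

Definition chain_map (f : forall n, {linear C n -> D n}) : Prop :=
  forall n x, f n (cdiff C n x) = cdiff D n (f n.+1 x).

Definition homotopic (f g : forall n, {linear C n -> D n}) : Prop :=
  exists h : forall n, {linear C n -> D n.+1},
    (forall x, f 0 x = g 0 x + cdiff D 0 (h 0 x)) /\
    (forall n x, f n.+1 x =
      g n.+1 x + (cdiff D n.+1 (h n.+1 x) + h n (cdiff C n x))).

Variables (f : forall n, {linear C n -> D n}) (fP : chain_map f).

Fact cycle_mapP n (z : submod (@cycles R C n)) :
  f n (submod_val z) \in @cycles R D n.
Proof.
case: n z => [|n] [z zP] //=; rewrite /in_mem /= -fP.
by rewrite (eqP (zP : cdiff C n z == 0)) linear0.
Qed.
Definition cycle_map n (z : submod (@cycles R C n)) := Submod (cycle_mapP z).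
Fact cycle_map_linear n : linear (@cycle_map n).
Proof. by move=> c x y; apply: val_inj; rewrite /= linearP. Qed.

Definition homology_map n : homology C n -> homology D n :=
  quot_map _ (mk_linear (@cycle_map_linear n)).

Fact cycle_map_boundaries n x :
  x \in @boundaries R C n -> mk_linear (@cycle_map_linear n) x \in
    @boundaries R D n.
Proof.
move=> /asboolP[y xy]; apply/asboolP; exists (f n.+1 y).
by rewrite -fP -xy.
Qed.

Lemma homology_mapE n z :
  @homology_map n (quot_proj _ z) = quot_proj _ (cycle_map z).
Proof. exact: (quot_mapE (@cycle_map_boundaries n)). Qed.

Fact homology_map_linear n : linear (@homology_map n).
Proof. exact: (quot_map_linear (@cycle_map_boundaries n)). Qed.

End ChainMaps.

Section ProjectiveLifts.
Variable R : pzRingType.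

Definition image_pred (A B : lmodType R) (f : {linear A -> B}) : {pred B} :=
  fun y => `[< exists x, y = f x >].
Fact image_closed (A B : lmodType R) (f : {linear A -> B}) :
  submod_closed (image_pred f).
Proof.
split=> [|c x y /asboolP[x' ->] /asboolP[y' ->]]; apply/asboolP.
  by exists 0; rewrite linear0.
by exists (c *: x' + y'); rewrite linearP.
Qed.
HB.instance Definition _ (A B : lmodType R) (f : {linear A -> B}) :=
  GRing.isSubmodClosed.Build R B (image_pred f)
    (GRing.submod_closed_semi (image_closed f)).

Lemma projective_lift (P A B : lmodType R) (u : {linear P -> B})
    (d : {linear A -> B}) : projective P -> (forall x, exists a, u x = d a) ->
  exists h : {linear P -> A}, forall x, u x = d (h x).
Proof.
move=> projP ud.
have uP x : u x \in image_pred d by apply/asboolP.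
have dP x : d x \in image_pred d by apply/asboolP; exists x.
pose u1 x : submod (image_pred d) := Submod (uP x).
pose d1 x : submod (image_pred d) := Submod (dP x).
have u1l : linear u1 by move=> c x y; apply: val_inj; rewrite /= linearP.
have d1l : linear d1 by move=> c x y; apply: val_inj; rewrite /= linearP.
have [|h hP] := projP _ _ (mk_linear d1l) (mk_linear u1l).
  by move=> [b bP]; have /asboolP[a ba] := bP; exists a; apply: val_inj.
by exists h => x; have /(congr1 (@submod_val _ _ _)) := hP x.
Qed.

Variables (M : lmodType R) (P Q : projective_resolution M).

Lemma lift_resolution : exists f : forall n, {linear P n -> Q n},
  chain_map f /\ forall x, res_aug Q (f 0 x) = res_aug P x.
Proof.
have [f0 f0P] : exists f0 : {linear P 0 -> Q 0},
    forall x, res_aug Q (f0 x) = res_aug P x.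
  exact: (@res_proj _ _ P 0 _ _ (res_aug Q) (res_aug P) (@res_surj _ _ Q)).
have [f1 f1P] : exists f1 : {linear P 1 -> Q 1},
    forall x, f0 (cdiff P 0 x) = cdiff Q 0 (f1 x).
  apply: (@projective_lift _ _ _ (f0 \o cdiff P 0)); first exact: res_proj.
  move=> x; apply/(res_exact0 (p := Q)); rewrite /= f0P.
  by apply/res_exact0; exists x.
pose T n := {p : {linear P n -> Q n} * {linear P n.+1 -> Q n.+1} |
  forall x, p.1 (cdiff P n x) = cdiff Q n (p.2 x)}.
have step n (p : T n) : {q : {linear P n.+2 -> Q n.+2} |
    forall x, (sval p).2 (cdiff P n.+1 x) = cdiff Q n.+1 (q x)}.
  apply: cid; case: p => -[p1 p2] /= pP.
  apply: (@projective_lift _ _ _ (p2 \o cdiff P n.+1)); first exact: res_proj.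
  by move=> x; apply/(res_exact (p := Q)); rewrite /= -pP cdiffK linear0.
pose fix s n : T n := match n with
  | 0 => exist _ (f0, f1) f1P
  | m.+1 => exist _ ((sval (s m)).2, sval (step m (s m))) (svalP (step m (s m)))
  end.
exists (fun n => (sval (s n)).1); split=> // n x.
exact: (svalP (s n)).
Qed.

Lemma lift_homotopic (f g : forall n, {linear P n -> Q n}) :
  chain_map f -> chain_map g ->
  (forall x, res_aug Q (f 0 x) = res_aug Q (g 0 x)) -> homotopic f g.
Proof.
move=> fP gP fg.
have [h0 h0P] : exists h0 : {linear P 0 -> Q 1},
    forall x, f 0 x - g 0 x = cdiff Q 0 (h0 x).
  apply: (@projective_lift _ _ _ (f 0 \- g 0)); first exact: res_proj.
  by move=> x; apply/(res_exact0 (p := Q)); rewrite /= linearB fg subrr.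
have [h1 h1P] : exists h1 : {linear P 1 -> Q 2},
    forall x, f 1 x - g 1 x - h0 (cdiff P 0 x) = cdiff Q 1 (h1 x).
  apply: (@projective_lift _ _ _ ((f 1 \- g 1) \- (h0 \o cdiff P 0))).
    exact: res_proj.
  move=> x; apply/(res_exact (p := Q)).
  by rewrite /= !linearB /= -h0P -fP -gP subrr.
pose T n := {p : {linear P n -> Q n.+1} * {linear P n.+1 -> Q n.+2} |
  forall x, f n.+1 x - g n.+1 x - p.1 (cdiff P n x) = cdiff Q n.+1 (p.2 x)}.
have step n (p : T n) : {q : {linear P n.+2 -> Q n.+3} | forall x,
    f n.+2 x - g n.+2 x - (sval p).2 (cdiff P n.+1 x) = cdiff Q n.+2 (q x)}.
  apply: cid; case: p => -[p1 p2] /= pP.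
  apply: (@projective_lift _ _ _ ((f n.+2 \- g n.+2) \- (p2 \o cdiff P n.+1))).
    exact: res_proj.
  move=> x; apply/(res_exact (p := Q)).
  by rewrite /= !linearB /= -pP -fP -gP cdiffK linear0 subr0 subrr.
pose fix s n : T n := match n with
  | 0 => exist _ (h0, h1) h1P
  | m.+1 => exist _ ((sval (s m)).2, sval (step m (s m))) (svalP (step m (s m)))
  end.
exists (fun n => (sval (s n)).1); split=> [x|n x] /=.
  by rewrite -h0P addrC subrK.
by have /= <- := svalP (s n) x; rewrite subrK addrC subrK.
Qed.

End ProjectiveLifts.

Section DerivedFunctors.
Variables (R S : pzRingType) (F : additive_functor R S).

Lemma fmap_eq0 (A B : lmodType R) (f : {linear A -> B}) :
  (forall x, f x = 0) -> forall x, fmap F f x = 0.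
Proof.
move=> f0 x; have ff : (f \+ f : {linear A -> B}) = f.
  by apply: linear_eq => y /=; rewrite f0 addr0.
by apply: (addIr (fmap F f x)); rewrite -fmap_add ff add0r.
Qed.

Fact fmap_cdiffK (C : complex R) n x :
  fmap F (cdiff C n) (fmap F (cdiff C n.+1) x) = 0.
Proof. by rewrite -fmap_comp fmap_eq0// => y /=; rewrite cdiffK. Qed.

Definition fcomplex (C : complex R) : complex S :=
  @Complex S (fun n => F (C n)) (fun n => fmap F (cdiff C n))
    (@fmap_cdiffK C).

(* Computed from one fixed projective resolution; by [left_derived_indep] below
   any other one gives an isomorphic module. *)
Definition left_derived (n : nat) (M : lmodType R) : lmodType S :=
  homology (fcomplex (free_resolution M)) n.

Theorem left_derived_indep (n : nat) (M : lmodType R)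
    (P : projective_resolution M) :
  exists f : {linear left_derived n M -> homology (fcomplex P) n}, bijective f.
Proof.
pose Q := free_resolution M.
have [f [fP fa]] := lift_resolution Q P.
have [g [gP ga]] := lift_resolution P Q.
have chF (A B : complex R) (h : forall n, {linear A n -> B n}) : chain_map h ->
    @chain_map _ (fcomplex A) (fcomplex B) (fun n => fmap F (h n)).
  move=> hP m x /=; rewrite -!fmap_comp.
  have -> : h m \o cdiff A m = cdiff B m \o h m.+1 :> {linear _ -> _}.
    by apply: linear_eq => y; apply: hP.
  by [].
pose Hf := homology_map (chF _ _ _ fP); pose Hg := homology_map (chF _ _ _ gP).
have K (A B : projective_resolution M) (u : forall n, {linear A n -> B n})
    (v : forall n, {linear B n -> A n}) (uP : chain_map u) (vP : chain_map v) :
    (forall x, res_aug B (u 0 x) = res_aug A x) ->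
    (forall x, res_aug A (v 0 x) = res_aug B x) ->
    cancel (homology_map (chF _ _ _ uP) (n := n))
           (homology_map (chF _ _ _ vP) (n := n)).
  move=> ua va z; rewrite -[z]quot_reprK; move: (repr z) => {}z.
  rewrite !homology_mapE; apply/quot_projP/asboolP => /=.
  have [|||h [h0 hS]] := @lift_homotopic _ _ A A
      (fun n => v n \o u n) (fun n => idfun).
  - by move=> m x /=; rewrite uP vP.
  - by [].
  - by move=> x /=; rewrite va ua.
  have homF m (y : fcomplex A m.+1) : fmap F (v m.+1) (fmap F (u m.+1) y) =
      y + (cdiff (fcomplex A) m.+1 (fmap F (h m.+1) y) +
      fmap F (h m) (cdiff (fcomplex A) m y)).
    rewrite -fmap_comp (linear_eq (g := idfun \+
      ((cdiff A m.+1 \o h m.+1) \+ (h m \o cdiff A m))) (hS m)).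
    by rewrite !fmap_add fmap_id !fmap_comp.
  have homF0 (y : fcomplex A 0) : fmap F (v 0) (fmap F (u 0) y) =
      y + cdiff (fcomplex A) 0 (fmap F (h 0) y).
    rewrite -fmap_comp (linear_eq (g := idfun \+ (cdiff A 0 \o h 0)) h0).
    by rewrite !fmap_add fmap_id !fmap_comp.
  exists (fmap F (h n) (submod_val z)).
  case: n z => [|m] [z zP] /=; first by rewrite homF0 addrC addKr.
  by rewrite homF (eqP (zP : _ == 0)) linear0 addr0 addrC addKr.
exists (mk_linear (homology_map_linear (chF _ _ _ fP) (n := n))).
by exists (@Hg n); apply: K.
Qed.

End DerivedFunctors.

Section Tensor.
Variables (R : comPzRingType) (N V : lmodType R).

Definition tensor_rels : set (freem R (N * V)%type) :=
  [set t | [\/ exists x y z, t = free_gen R (x + y, z) -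
                                 (free_gen R (x, z) + free_gen R (y, z)),
               exists x y z, t = free_gen R (x, y + z) -
                                 (free_gen R (x, y) + free_gen R (x, z)),
               exists c x y, t = free_gen R (c *: x, y) -
                                 c *: free_gen R (x, y) |
               exists c x y, t = free_gen R (x, c *: y) -
                                 c *: free_gen R (x, y)]].

Definition tensor : lmodType R := quotm (span tensor_rels).

End Tensor.

Section TensorFunctor.
Variables (R : comPzRingType) (N : lmodType R).

Definition tensor_pre (A B : lmodType R) (f : {linear A -> B}) :
    {linear freem R (N * A)%type -> freem R (N * B)%type} :=
  free_lift (fun p : (N * A)%type => free_gen R (p.1, f p.2)).

Fact tensor_pre_rels (A B : lmodType R) (f : {linear A -> B}) x :
  x \in span (@tensor_rels R N A) ->
  tensor_pre f x \in span (@tensor_rels R N B).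
Proof.
have E := free_lift_gen (fun p : (N * A)%type => free_gen R (p.1, f p.2)).
move=> /asboolP[s [Es ->]]; rewrite linear_sum; apply/asboolP.
exists [seq (p.1, tensor_pre f p.2) | p <- s]; split=> [q|]; last first.
  by rewrite big_map; apply: eq_bigr => p _; rewrite linearZ.
move=> /mapP[p /Es + ->] /=; rewrite /tensor_pre => -[|||] [a [b [c ->]]].
- by constructor 1; exists a, b, (f c); rewrite linearB linearD /= !E.
- constructor 2; exists a, (f b), (f c).
  by rewrite linearB linearD /= !E linearD.
- by constructor 3; exists a, b, (f c); rewrite linearB linearZ /= !E.
- by constructor 4; exists a, b, (f c); rewrite linearB linearZ /= !E linearZ.
Qed.

Definition tensor_map (A B : lmodType R) (f : {linear A -> B}) :
  tensor N A -> tensor N B := quot_map _ (tensor_pre f).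
HB.instance Definition _ (A B : lmodType R) (f : {linear A -> B}) :=
  GRing.isLinear.Build R (tensor N A) (tensor N B) *:%R (tensor_map f)
    (quot_map_linear (@tensor_pre_rels A B f)).

Lemma tensor_preE (A B : lmodType R) (f : {linear A -> B}) y x :
  tensor_pre f (free_gen R (y, x)) = free_gen R (y, f x).
Proof. exact: free_lift_gen. Qed.

Lemma tensor_mapE (A B : lmodType R) (f : {linear A -> B}) u :
  tensor_map f (quot_proj _ u) = quot_proj _ (tensor_pre f u).
Proof. exact: (quot_mapE (@tensor_pre_rels A B f)). Qed.

Lemma tensor_ext (A B : lmodType R) (f g : {linear tensor N A -> B}) :
  (forall y x, f (quot_proj _ (free_gen R (y, x))) =
               g (quot_proj _ (free_gen R (y, x)))) -> f =1 g.
Proof.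
move=> fg u; rewrite -[u]quot_reprK.
apply: (free_ext (f := f \o quot_proj _) (g := g \o quot_proj _)) => -[y x].
exact: fg.
Qed.

Fact tensor_map_id (A : lmodType R) x :
  tensor_map (idfun : {linear A -> A}) x = x.
Proof.
apply: (tensor_ext (f := tensor_map _) (g := idfun)) => y z.
by rewrite /= tensor_mapE tensor_preE.
Qed.

Fact tensor_map_comp (A B C : lmodType R)
    (f : {linear B -> C}) (g : {linear A -> B}) x :
  tensor_map (f \o g : {linear A -> C}) x = tensor_map f (tensor_map g x).
Proof.
apply: (tensor_ext (f := tensor_map _) (g := tensor_map f \o tensor_map g)).
by move=> y z; rewrite /= [tensor_map g _]tensor_mapE !tensor_mapE !tensor_preE.
Qed.

Fact tensor_map_add (A B : lmodType R) (f g : {linear A -> B}) x :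
  tensor_map (f \+ g : {linear A -> B}) x = tensor_map f x + tensor_map g x.
Proof.
apply: (tensor_ext (f := tensor_map _) (g := tensor_map f \+ tensor_map g)).
move=> y z; rewrite /= !tensor_mapE !tensor_preE -linearD.
apply/(@quot_projP _ _ (span (@tensor_rels R N B))).
apply: mem_span; apply: Or42.
by exists y, (f z), (g z).
Qed.

Definition tensor_functor : additive_functor R R :=
  @AdditiveFunctor R R (tensor N) (fun A B f => tensor_map f)
    tensor_map_id tensor_map_comp tensor_map_add.

End TensorFunctor.

(* The left derived functors of [N (x) _], evaluated at [M]. *)
Definition Tor (R : comPzRingType) (n : nat) (N M : lmodType R) : lmodType R :=
  left_derived (tensor_functor N) n M.

(* Ideals are the submodules of the regular module. *)
Notation ideal R := (submodClosed R^o).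

Section Adic.
Variables (R : comPzRingType) (a : ideal R).

(* The submodule generated by the products of elements of [b] and [N]. *)
Definition ideal_mul (b : ideal R) (V : lmodType R) (N : submodClosed V) :
    submodClosed V :=
  span [set v | exists r x, [/\ r \in b, x \in N & v = r *: x]].

Fixpoint ideal_pow (n : nat) : ideal R :=
  if n is m.+1 then ideal_mul a (ideal_pow m) else full_submod R^o.

Definition adic_submod (V : lmodType R) (n : nat) : submodClosed V :=
  ideal_mul (ideal_pow n) (full_submod V).

Definition adic_quot (V : lmodType R) (n : nat) : lmodType R :=
  quotm (adic_submod V n).

Lemma mem_ideal_mul (b : ideal R) (V : lmodType R) (N : submodClosed V) r x :
  r \in b -> x \in N -> r *: x \in ideal_mul b N.
Proof. by move=> rb xN; apply: mem_span; exists r, x. Qed.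

Lemma mem_adic (V : lmodType R) n r (x : V) :
  r \in ideal_pow n -> r *: x \in adic_submod V n.
Proof. by move=> rb; apply: mem_ideal_mul. Qed.

Lemma ideal_pow_sub n r : r \in ideal_pow n.+1 -> r \in ideal_pow n.
Proof.
apply: span_min => _ [s [t [sa tb ->]]].
by rewrite -[_ *: _]addr0 submodP ?submod0.
Qed.

Lemma adic_sub (V : lmodType R) n x :
  x \in adic_submod V n.+1 -> x \in adic_submod V n.
Proof.
apply: span_min => _ [r [y [ra _ ->]]].
by apply: mem_adic; apply: ideal_pow_sub.
Qed.

Lemma adic_map (V W : lmodType R) (f : {linear V -> W}) n x :
  x \in adic_submod V n -> f x \in adic_submod W n.
Proof.
move=> /asboolP[s [Es ->]]; rewrite linear_sum; apply/asboolP.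
exists [seq (p.1, f p.2) | p <- s]; split=> [q|].
  move=> /mapP[p /Es[r [y [ra _ pE]]] ->] /=.
  by exists r, (f y); split=> //; rewrite pE linearZ.
by rewrite big_map; apply: eq_bigr => p _; rewrite linearZ.
Qed.

Definition adic_trans (V : lmodType R) (n : nat) :
  adic_quot V n.+1 -> adic_quot V n := quot_map _ (idfun : {linear V -> V}).

(* The inverse limit of the [V/a^nV]: since the index set is [nat],
   compatibility with the transition maps from [n.+1] to [n] suffices. *)
Record completion (V : lmodType R) := Completion {
  compl_val : forall n, adic_quot V n;
  compl_valP : forall n, adic_trans (compl_val n.+1) = compl_val n }.

End Adic.

HB.instance Definition _ (R : comPzRingType) (a : ideal R) (V : lmodType R) :=
  gen_eqMixin (completion a V).
HB.instance Definition _ (R : comPzRingType) (a : ideal R) (V : lmodType R) :=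
  gen_choiceMixin (completion a V).

Section CompletionZmod.
Variables (R : comPzRingType) (a : ideal R) (V : lmodType R).
Implicit Types x y z : completion a V.

Lemma adic_transE n v :
  adic_trans (quot_proj (adic_submod a V n.+1) v) = quot_proj _ v.
Proof. exact: (quot_mapE (f := idfun) (@adic_sub _ a V n)). Qed.

Lemma adic_trans_linear n : linear (@adic_trans _ a V n).
Proof. exact: (quot_map_linear (f := idfun) (@adic_sub _ a V n)). Qed.
HB.instance Definition _ n := GRing.isLinear.Build R (adic_quot a V n.+1)
  (adic_quot a V n) *:%R (@adic_trans _ a V n) (@adic_trans_linear n).

Lemma compl_eq x y : (forall n, compl_val x n = compl_val y n) -> x = y.
Proof.
case: x y => [x xP] [y yP] /= xy.
have {}xy : x = y := functional_extensionality_dep xy.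
by subst y; rewrite (Prop_irrelevance xP yP).
Qed.

Fact compl0P n : adic_trans (0 : adic_quot a V n.+1) = 0.
Proof. exact: linear0. Qed.
Definition compl0 := Completion compl0P.

Fact compl_oppP x n :
  adic_trans (- compl_val x n.+1) = - compl_val x n.
Proof.
by rewrite linearN /= compl_valP.
Qed.
Definition compl_opp x := Completion (compl_oppP x).

Fact compl_addP x y n :
  adic_trans (compl_val x n.+1 + compl_val y n.+1) =
  compl_val x n + compl_val y n.
Proof.
by rewrite linearD /= !compl_valP.
Qed.
Definition compl_add x y := Completion (compl_addP x y).

Fact compl_addA : associative compl_add.
Proof. by move=> x y z; apply: compl_eq => n /=; rewrite addrA. Qed.
Fact compl_addC : commutative compl_add.
Proof. by move=> x y; apply: compl_eq => n /=; rewrite addrC. Qed.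
Fact compl_add0 : left_id compl0 compl_add.
Proof. by move=> x; apply: compl_eq => n /=; rewrite add0r. Qed.
Fact compl_addN : left_inverse compl0 compl_opp compl_add.
Proof. by move=> x; apply: compl_eq => n /=; rewrite addNr. Qed.
HB.instance Definition _ := GRing.isZmodule.Build (completion a V)
  compl_addA compl_addC compl_add0 compl_addN.

End CompletionZmod.

Section CompletionAction.
Variables (R : comPzRingType) (a : ideal R) (V : lmodType R).

Definition scale_at (v : V) : R^o -> V := fun r => (r : R) *: v.
Fact scale_at_linear v : linear (scale_at v).
Proof. by move=> c r s; rewrite /scale_at scalerDl scalerA. Qed.
HB.instance Definition _ v :=
  GRing.isLinear.Build R R^o V *:%R (scale_at v) (scale_at_linear v).

(* The action of [R/a^n] on [V/a^nV], where [R/a^n] is [adic_quot a R^o n]. *)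
Definition adic_act (n : nat) (r : adic_quot a R^o n) (v : adic_quot a V n) :
  adic_quot a V n := quot_proj _ ((repr r : R) *: repr v).

Lemma adic_actE n (r : R^o) (v : V) :
  adic_act (quot_proj (adic_submod a R^o n) r) (quot_proj _ v) =
  quot_proj _ ((r : R) *: v).
Proof.
rewrite /adic_act; set r' := repr _; set v' := repr _; apply/quot_projP.
have -> : (r' : R) *: v' - (r : R) *: v =
    (r' : R) *: (v' - v) + ((r' : R) - r) *: v.
  by rewrite scalerBr scalerBl addrA subrK.
apply: submodP; first exact: quot_reprP.
exact: (adic_map (scale_at v) (quot_reprP (adic_submod a R^o n) r)).
Qed.

Fact compl_actP (r : completion a R^o) x n :
  adic_trans (adic_act (compl_val r n.+1) (compl_val x n.+1)) =
  adic_act (compl_val r n) (compl_val x n).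
Proof.
rewrite -(compl_valP r n) -(compl_valP x n).
rewrite -[compl_val r _]quot_reprK -[compl_val x _]quot_reprK.
by rewrite adic_actE !adic_transE adic_actE.
Qed.
Definition compl_act r x := Completion (compl_actP r x).


Lemma adic_act_ind n (P : adic_quot a V n -> Prop) :
  (forall v, P (quot_proj _ v)) -> forall v, P v.
Proof. by move=> H v; rewrite -[v]quot_reprK. Qed.

Lemma adic_actDr n r (v w : adic_quot a V n) :
  adic_act r (v + w) = adic_act r v + adic_act r w.
Proof.
rewrite -[r]quot_reprK; elim/adic_act_ind: v => v; elim/adic_act_ind: w => w.
by rewrite -linearD /= !adic_actE scalerDr linearD.
Qed.

Lemma adic_actDl n r s (v : adic_quot a V n) :
  adic_act (r + s) v = adic_act r v + adic_act s v.
Proof.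
rewrite -[r]quot_reprK -[s]quot_reprK; elim/adic_act_ind: v => v.
by rewrite -linearD /= !adic_actE scalerDl linearD.
Qed.

End CompletionAction.

Section CompletionRing.
Variables (R : comPzRingType) (a : ideal R).

Definition adic_one n : adic_quot a R^o n :=
  quot_proj (adic_submod a R^o n) (1 : R).
Fact compl1P n : adic_trans (adic_one n.+1) = adic_one n.
Proof. exact: adic_transE. Qed.
Definition compl1 := Completion compl1P.

Lemma adic_act1 (V : lmodType R) n (v : adic_quot a V n) :
  adic_act (adic_one n) v = v.
Proof.
by elim/adic_act_ind: v => v; rewrite adic_actE scale1r.
Qed.

Lemma adic_actA (V : lmodType R) n (r s : adic_quot a R^o n)
    (v : adic_quot a V n) :
  adic_act r (adic_act s v) = adic_act (adic_act r s) v.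
Proof.
rewrite -[r]quot_reprK -[s]quot_reprK; elim/adic_act_ind: v => v.
by rewrite !adic_actE scalerA.
Qed.

Lemma adic_actC n (r s : adic_quot a R^o n) : adic_act r s = adic_act s r.
Proof.
rewrite -[r]quot_reprK -[s]quot_reprK !adic_actE.
by congr quot_proj; apply: mulrC.
Qed.

(* [R/a^n] is [R/a^nR], so the completed ring is the completion of the regular
   module, with the multiplication of each [R/a^n] acting componentwise. *)
Definition compl_ring := completion a R^o.
HB.instance Definition _ := GRing.Zmodule.on compl_ring.

Fact compl_mulA : associative (@compl_act R a R^o).
Proof. by move=> x y z; apply: compl_eq => n; apply: adic_actA. Qed.
Fact compl_mulC : commutative (@compl_act R a R^o).
Proof. by move=> x y; apply: compl_eq => n; apply: adic_actC. Qed.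
Fact compl_mul1 : left_id compl1 (@compl_act R a R^o).
Proof. by move=> x; apply: compl_eq => n; apply: adic_act1. Qed.
Fact compl_mulDl : left_distributive (@compl_act R a R^o) +%R.
Proof. by move=> x y z; apply: compl_eq => n; apply: adic_actDl. Qed.
HB.instance Definition _ := GRing.Zmodule_isComPzRing.Build compl_ring
  compl_mulA compl_mulC compl_mul1 compl_mulDl.

Variable V : lmodType R.

Fact compl_scaleA (r s : compl_ring) (x : completion a V) :
  compl_act r (compl_act s x) = compl_act (r * s) x.
Proof. by apply: compl_eq => n; apply: adic_actA. Qed.
Fact compl_scale1 : left_id (1 : compl_ring) (@compl_act R a V).
Proof. by move=> x; apply: compl_eq => n; apply: adic_act1. Qed.
Fact compl_scaleDr : right_distributive (@compl_act R a V) +%R.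
Proof. by move=> r x y; apply: compl_eq => n; apply: adic_actDr. Qed.
Fact compl_scaleDl (x : completion a V) :
  {morph (@compl_act R a V)^~ x : r s / r + s}.
Proof. by move=> r s; apply: compl_eq => n; apply: adic_actDl. Qed.
HB.instance Definition _ := GRing.Zmodule_isLmodule.Build compl_ring
  (completion a V) compl_scaleA compl_scale1 compl_scaleDr compl_scaleDl.

End CompletionRing.

Section CompletionFunctor.
Variables (R : comPzRingType) (a : ideal R).

Definition adic_fmap (A B : lmodType R) (f : {linear A -> B}) n :
  adic_quot a A n -> adic_quot a B n := quot_map _ f.

Lemma adic_fmapE (A B : lmodType R) (f : {linear A -> B}) n (x : A) :
  adic_fmap f (quot_proj (adic_submod a A n) x) = quot_proj _ (f x).
Proof. exact: (quot_mapE (@adic_map _ a A B f n)). Qed.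

Lemma adic_fmapD (A B : lmodType R) (f : {linear A -> B}) n :
  {morph @adic_fmap A B f n : x y / x + y}.
Proof.
move=> x y; rewrite -[x]scale1r.
by rewrite [LHS](quot_map_linear (@adic_map _ a A B f n)) !scale1r.
Qed.

Lemma adic_fmap_act (A B : lmodType R) (f : {linear A -> B}) n r x :
  @adic_fmap A B f n (adic_act r x) = adic_act r (adic_fmap f x).
Proof.
rewrite -[r]quot_reprK; elim/adic_act_ind: x => x.
by rewrite adic_actE !adic_fmapE adic_actE linearZ.
Qed.

Fact compl_mapP (A B : lmodType R) (f : {linear A -> B})
    (x : completion a A) n :
  adic_trans (adic_fmap f (compl_val x n.+1)) = adic_fmap f (compl_val x n).
Proof.
rewrite -(compl_valP x n) -[compl_val x _]quot_reprK.
by rewrite adic_transE !adic_fmapE adic_transE.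
Qed.
Definition compl_map (A B : lmodType R) (f : {linear A -> B})
    (x : completion a A) :=
  Completion (compl_mapP f x).

Fact compl_map_linear (A B : lmodType R) (f : {linear A -> B}) :
  linear (compl_map f : completion a A -> completion a B).
Proof.
move=> r x y; apply: compl_eq => n.
by rewrite [LHS]adic_fmapD adic_fmap_act.
Qed.
HB.instance Definition _ (A B : lmodType R) (f : {linear A -> B}) :=
  GRing.isLinear.Build (compl_ring a) (completion a A) (completion a B) *:%R
    (compl_map f) (compl_map_linear f).

Fact compl_map_id (A : lmodType R) (x : completion a A) :
  compl_map (idfun : {linear A -> A}) x = x.
Proof.
by apply: compl_eq => n /=; rewrite -[compl_val x n]quot_reprK adic_fmapE.
Qed.

Fact compl_map_comp (A B C : lmodType R) (f : {linear B -> C})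
    (g : {linear A -> B}) (x : completion a A) :
  compl_map (f \o g : {linear A -> C}) x = compl_map f (compl_map g x).
Proof.
apply: compl_eq => n /=; rewrite -[compl_val x n]quot_reprK.
by rewrite [adic_fmap g _]adic_fmapE !adic_fmapE.
Qed.

Fact compl_map_add (A B : lmodType R) (f g : {linear A -> B})
    (x : completion a A) :
  compl_map (f \+ g : {linear A -> B}) x = compl_map f x + compl_map g x.
Proof.
apply: compl_eq => n /=; rewrite -[compl_val x n]quot_reprK.
by rewrite !adic_fmapE -linearD.
Qed.

Definition completion_functor : additive_functor R (compl_ring a) :=
  @AdditiveFunctor R (compl_ring a) (completion a)
    (fun A B f => compl_map f) compl_map_id compl_map_comp compl_map_add.

Definition local_homology (n : nat) (M : lmodType R) :
    lmodType (compl_ring a) :=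
  left_derived completion_functor n M.

(* The supremum is taken in the extended integers, with sup of the empty set
   equal to [-oo]. *)
Definition hdim (M : lmodType R) : \bar int :=
  supremum -oo%E
    [set (Posz i)%:E | i in [set i | exists x : local_homology i M, x != 0]].

Lemma le_hdim (M : lmodType R) (i : nat) :
  ((Posz i)%:E <= hdim M)%E <->
  exists j, (i <= j)%N /\ exists x : local_homology j M, x != 0.
Proof.
rewrite /hdim; set N := [set j | exists x : local_homology j M, x != 0].
have lefin (j k : nat) :
    ((Posz j)%:E <= (Posz k)%:E :> \bar int)%E = (j <= k)%N.
  by [].
split=> [iA|[j [ij Nj]]]; last first.
  apply: (@le_trans _ _ ((Posz j)%:E)); first by rewrite lefin.
  apply: ge_supremum_Nmem; last by exists j.
  have [[b bN]|nb] := pselect (exists b, ubound N b).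
    have [k [uk lk]] : supremums N !=set0.
      by apply: nat_supremums_neq0; exists b.
    exists (Posz k)%:E; split=> [_ [m Nm <-]|e ue]; first exact: uk.
    have Nk : N k.
      apply: contrapT => Nk; have k0 : (0 < k)%N.
        rewrite lt0n; apply/eqP => k0; have := uk _ Nj; rewrite k0.
        by rewrite leEnat leqn0 => /eqP jE; apply: Nk; rewrite k0 -jE.
      suff : (k <= k.-1)%N by rewrite leqNgt ltn_predL k0.
      apply: lk => m Nm; have := uk _ Nm; rewrite !leEnat leq_eqVlt.
      by move=> /orP[/eqP mk|]; [case: Nk; rewrite -mk|case: (k) k0].
    by apply: ue; exists k.
  exists +oo%E; split=> [e _|e ue]; first exact: leey.
  case: e ue => [e||] ue //; last by have /= := ue _ (ex_intro2 _ _ j Nj erefl).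
  case: nb; exists `|e|%N => m Nm.
  have := ue _ (ex_intro2 _ _ m Nm erefl); rewrite lee_fin leEnat => me.
  by rewrite -lez_nat (le_trans me)// lez_abs.
apply: contrapT => H.
have /= ub : ubound [set (Posz j)%:E | j in N] (Posz i - 1)%:E.
  move=> _ [j Nj <-]; rewrite lee_fin lerBrDr; apply: contrapT => /negP.
  by rewrite -ltNge ltzD1 lez_nat => ij; apply: H; exists j.
move: iA; rewrite /supremum; case: ifPn => // _.
case: xgetP => // y _ [_ /(_ _ ub)].
move=> yi iy; have := le_trans iy yi.
by rewrite lee_fin lerBrDr => /le_gtF; rewrite ltrDl.
Qed.

End CompletionFunctor.

Definition finitely_generated (R : pzRingType) (V : lmodType R) : Prop :=
  exists n (g : 'I_n -> V), forall v, exists c : 'I_n -> R,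
    v = \sum_(i < n) c i *: g i.

Definition noetherian (R : comPzRingType) : Prop :=
  forall b : ideal R, finitely_generated (submod b).

(* Main.v *)
Require Import Defs.
From HB Require Import structures.
From mathcomp Require Import all_boot all_order all_algebra.
From mathcomp Require Import boolp.
From mathcomp Require Import constructive_ereal.

Set Implicit Arguments.
Unset Strict Implicit.
Unset Printing Implicit Defensive.

Import GRing.Theory.
Local Open Scope ring_scope.
Local Open Scope quotient_scope.

(** The idea is to compare everything with one complex.  Let [P] be a free
    resolution of [M], let [S] be the completion of [R], let [x_1, .., x_r]
    generate [a] and let [b] be the ideal that their images generate in [S].
    Put [C = completion P].  Then [H_i(C)] is the local homology of [M], and
    [C / bC = P / aP = R/a (x) P], so that [H_i(C / bC)] is
    [Tor_i(R/a, M)].  It is therefore enough to show, for every [n], that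
    [H_i(C)] is finitely generated for all [i <= n] if and only if
    [H_i(C / bC)] is ([fg_homology_mod], [local_homology_Tor_fg]).  Letting
    [n] grow, this is the equivalence of the two finiteness conditions.  It
    also shows that the Tor modules up to the homological dimension suffice:
    for [n] up to that bound they control the local homology, which is zero,
    hence finitely generated, above it.

    Three properties of [C] and [S] are used.

    - Nakayama for complete modules ([complete_nakayama]): if [A] is complete,
      [B] is separated and [B = f(A) + bB], then [f : A -> B] is surjective,
      by successive approximation.

    - The [C_i] are complete, and they have the lifting property of projective
      modules for surjections between complete modules
      ([cproj_completion_free]): a map out of the completion of a free module
      into a complete module is determined by the images of the basis, and
      these may be chosen freely.

    - [S] is noetherian ([compl_ring_noetherian]).  This is deduced from a
      principle in the style of Cohen ([fg_of_element]): in a complete ring an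
      ideal [N] is finitely generated as soon as all the ideals that contain
      both [N] and one given [x_i] are so.  Adjoining the [x_i] one at a time
      reduces the claim to the ideals that contain [b], and those come from
      [R].

    The comparison goes by induction on [n], by dimension shifting.  If [H_0]
    of either complex is finitely generated, Nakayama yields a finitely
    generated complete projective module [F] and a surjection
    [F (+) C_1 -> C_0].  It splits, so its kernel [K] is again complete
    projective, and [.. -> C_3 -> C_2 -> K] is a complex of the same kind.
    Its homology in degree [i >= 1] is [H_(i+1)(C)], and in degree [0] it is an
    extension of a submodule of [F] by [H_1(C)].  The splitting makes the same
    description valid modulo [b].  Since [S] is noetherian, finite generation
    in degrees [<= n] for the new complex is finite generation in degrees
    [1, .., n + 1] for [C], and the same holds modulo [b]. *)

(** * Finite generation modulo a submodule *)

Section Generation.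
Variables (S : pzRingType) (V : lmodType S).
Implicit Types (N K : V -> Prop) (s t : seq V).

Definition submodule N :=
  N 0 /\ forall c x y, N x -> N y -> N (c *: x + y).

Lemma submodule0 N : submodule N -> N 0. Proof. by case. Qed.

Lemma submoduleZ N c x : submodule N -> N x -> N (c *: x).
Proof. by move=> [N0 NP] Nx; rewrite -[_ *: _]addr0; apply: NP. Qed.

Lemma submoduleD N x y : submodule N -> N x -> N y -> N (x + y).
Proof. by move=> [N0 NP] Nx Ny; rewrite -[x]scale1r; apply: NP. Qed.

Lemma submoduleB N x y : submodule N -> N x -> N y -> N (x - y).
Proof. by move=> [N0 NP] Nx Ny; rewrite addrC -scaleN1r; apply: NP. Qed.

Lemma submodule_sum N (I : Type) (r : seq I) (F : I -> V) :
  submodule N -> (forall i, N (F i)) -> N (\sum_(i <- r) F i).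
Proof.
move=> NP NF; elim/big_rec: _ => [|i x _ Nx]; first exact: submodule0.
exact: submoduleD.
Qed.

Lemma submodule_eq0 : submodule (fun v : V => v = 0).
Proof. by split=> // c x y -> ->; rewrite scaler0 addr0. Qed.

Lemma submoduleI N K : submodule N -> submodule K ->
  submodule (fun v => N v /\ K v).
Proof.
move=> NP KP; split=> [|c x y [Nx Kx] [Ny Ky]].
  by split; apply: submodule0.
by split; [apply: (proj2 NP)|apply: (proj2 KP)].
Qed.

(** [v] lies in [K] plus the span of [s].  Recursion on the list of generators,
    with [K] at the bottom, makes both extensions of generating lists and
    induction on the number of generators immediate. *)
Fixpoint gen K s : V -> Prop :=
  if s is g :: s' then fun v => exists c : S, gen K s' (v - c *: g) else K.

(** For [K] contained in [N] this says that [N / K] is finitely generated; it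
    avoids forming the quotient, and [K] may also be larger than [N]. *)
Definition fg_mod N K :=
  exists s, (forall g, g \in s -> N g) /\ (forall v, N v -> gen K s v).

Lemma gen_sub K s : submodule K -> submodule (gen K s).
Proof.
move=> KP; elim: s => [|g s IH] //; split=> [|c x y [cx Kx] [cy Ky]] /=.
  by exists 0; rewrite scale0r subr0; apply: submodule0.
exists (c * cx + cy); rewrite scalerDl opprD addrACA -scalerA -scalerBr.
exact: (proj2 IH).
Qed.

Lemma gen_min K s N : submodule N -> (forall v, K v -> N v) ->
  (forall g, g \in s -> N g) -> forall v, gen K s v -> N v.
Proof.
move=> NP KN; elim: s => [|g s IH] sN v /=; first exact: KN.
move=> [c cv]; rewrite -(subrK (c *: g) v).
apply: submoduleD => //; last by apply: submoduleZ => //; exact/sN/mem_head.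
by apply: IH cv => h hs; apply: sN; rewrite inE hs orbT.
Qed.

Lemma genS K K' s v : (forall w, K w -> K' w) -> gen K s v -> gen K' s v.
Proof.
move=> KK'; elim: s v => [|g s IH] v /=; first exact: KK'.
by move=> [c cv]; exists c; apply: IH.
Qed.

Lemma gen_add K s v w : gen (fun v => v = 0) s v -> K (w - v) -> gen K s w.
Proof.
elim: s v w => [|g s IH] v w /=; first by move=> ->; rewrite subr0.
move=> [c cv] Kwv; exists c; apply: IH cv _.
by rewrite opprB addrA subrK.
Qed.

Lemma gen_cat K s t v : gen (gen K t) s v -> gen K (s ++ t) v.
Proof.
by elim: s v => [|g s IH] v //= [c cv]; exists c; apply: IH.
Qed.

(** The quotient [N / K] is an extension of [N / K1] by [(N /\ K1) / K]. *)
Lemma fg_ext N K K1 : submodule N -> fg_mod N K1 ->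
  fg_mod (fun v => N v /\ K1 v) K -> fg_mod N K.
Proof.
move=> NP [s [sN Ns]] [t [tN Nt]]; exists (s ++ t); split=> [g|v Nv].
  by rewrite mem_cat => /orP[/sN|/tN[]].
apply: gen_cat.
have : gen (fun w => N w /\ K1 w) s v; last first.
  by apply: genS => w; apply: Nt.
elim: s sN v Nv {Ns} (Ns v Nv) => [|g s IH] sN v Nv /=; first by [].
move=> [c cv]; exists c; apply: IH cv.
  by move=> h hs; apply: sN; rewrite inE hs orbT.
by apply: submoduleB => //; apply: submoduleZ => //; exact/sN/mem_head.
Qed.

Lemma fg_modS N K K' : (forall w, K w -> K' w) -> fg_mod N K -> fg_mod N K'.
Proof.
move=> KK' [s [sN Ns]]; exists s; split=> // v /Ns; exact: genS.
Qed.

Lemma fg_mod_eq N N' K : (forall v, N v <-> N' v) -> fg_mod N K -> fg_mod N' K.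
Proof.
by move=> NN' [s [sN Ns]]; exists s; split=> [g /sN/NN'|v /NN' /Ns].
Qed.

Lemma gen_sum n (c : 'I_n -> S) (g : 'I_n -> V) :
  gen (fun v => v = 0) [seq g i | i <- index_enum 'I_n] (\sum_i c i *: g i).
Proof.
elim: (index_enum _) => [|i s IH] /=; first by rewrite big_nil.
by exists (c i); rewrite big_cons addrC addKr.
Qed.

Lemma finitely_generatedP :
  finitely_generated V <-> fg_mod (fun _ => True) (fun v => v = 0).
Proof.
split=> [[n [g gP]]|[s [_ sP]]].
  exists [seq g i | i <- index_enum 'I_n]; split=> // v _; have [c ->] := gP v.
  exact: gen_sum.
exists (size s), (fun i => nth 0 s i) => v; move: (sP v I) => {sP}.
elim: s v => [|g s IH] v /=; first by exists (fun=> 0); rewrite big_ord0.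
move=> [c0 /IH[c cP]].
exists (fun i => if unlift ord0 i is Some j then c j else c0).
rewrite big_ord_recl unlift_none /= -[v](subrK (c0 *: g)) addrC cP.
by congr (_ + _); apply: eq_bigr => i _; rewrite liftK.
Qed.

End Generation.

(** A linear correspondence [Phi] between two modules carries generators to
    generators.  Working with correspondences instead of maps treats
    projections, inclusions and their partial inverses alike, and the two
    modules may live over different rings: each scalar of the first ring only
    has to have a scalar of the second ring that acts compatibly. *)
Section Transfer.
Variables (R S : pzRingType) (A : lmodType R) (B : lmodType S).
Variable Phi : A -> B -> Prop.
Hypothesis Phi0 : Phi 0 0.
Hypothesis PhiB : forall a b a' b',
  Phi a b -> Phi a' b' -> Phi (a - a') (b - b').
Hypothesis PhiZ : forall c, exists c', forall a b,
  Phi a b -> Phi (c *: a) (c' *: b).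

Let PhiD a b a' b' : Phi a b -> Phi a' b' -> Phi (a + a') (b + b').
Proof.
move=> ab /(PhiB Phi0); rewrite !sub0r => /(PhiB ab).
by rewrite !opprK.
Qed.

Lemma gen_lift (NA KA : A -> Prop) (NB : B -> Prop) (s : seq A) :
  (forall g, g \in s -> exists b, NB b /\ Phi g b) ->
  exists t, (forall b, b \in t -> NB b) /\
    forall a, gen KA s a -> exists a' b,
      [/\ gen (fun v => v = 0) t b, Phi a' b & KA (a - a')].
Proof.
elim: s => [|g s IH] sN.
  exists [::]; split=> // a /= Ka; exists 0, 0; split=> //.
  by rewrite subr0.
have [t [tN tP]] := IH (fun h hs => sN h (mem_behead (s := g :: s) hs)).
have [b [Nb gb]] := sN g (mem_head _ _).
exists (b :: t); split=> [h|a /= [c ca]].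
  by rewrite inE => /orP[/eqP->|/tN].
have [a1 [b1 [tb1 ab1 Ka1]]] := tP _ ca; have [c' cP] := PhiZ c.
exists (a1 + c *: g), (b1 + c' *: b); split.
- by exists c'; rewrite addrK.
- by apply: PhiD => //; apply: cP.
- by rewrite opprD addrA addrAC.
Qed.

Lemma fg_transfer (NA KA : A -> Prop) (NB KB : B -> Prop) :
  (forall a, NA a -> exists b, NB b /\ Phi a b) ->
  (forall b, NB b -> exists a, NA a /\ Phi a b) ->
  (forall a b, Phi a b -> KA a -> KB b) ->
  fg_mod NA KA -> fg_mod NB KB.
Proof.
move=> AB BA AK [s [sN Ns]].
have [g|t [tN tP]] := @gen_lift NA KA NB s; first by move=> /sN/AB.
exists t; split=> // b /BA[a [/Ns/tP[a' [b' [tb' ab' Ka']]] ab]].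
by apply: (gen_add tb'); apply: AK Ka'; apply: PhiB.
Qed.

End Transfer.

Lemma fg_correspondence (S : pzRingType) (A B : lmodType S)
    (Phi : A -> B -> Prop) (NA KA : A -> Prop) (NB KB : B -> Prop) :
  Phi 0 0 ->
  (forall a b a' b', Phi a b -> Phi a' b' -> Phi (a - a') (b - b')) ->
  (forall c a b, Phi a b -> Phi (c *: a) (c *: b)) ->
  (forall a, NA a -> exists b, NB b /\ Phi a b) ->
  (forall b, NB b -> exists a, NA a /\ Phi a b) ->
  (forall a b, Phi a b -> KA a <-> KB b) ->
  fg_mod NA KA <-> fg_mod NB KB.
Proof.
move=> Phi0 PhiB PhiZ AB BA PhiK; split.
  apply: (fg_transfer (Phi := Phi)) => // [c|a b /PhiK[]//].
  by exists c; apply: PhiZ.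
apply: (fg_transfer (Phi := fun b a => Phi a b)) => //.
- by move=> b a b' a'; apply: PhiB.
- by move=> c; exists c => b a; apply: PhiZ.
- by move=> b a /PhiK[].
Qed.

(** * Noetherian rings *)

Section Noetherian.
Variables (S : comPzRingType).
Hypothesis noethS : noetherian S.

Lemma noetherian_fg_ideal (L : S^o -> Prop) :
  submodule L -> fg_mod L (fun v => v = 0).
Proof.
move=> LP.
have Lclosed : submod_closed (fun v : S^o => `[< L v >]).
  split=> [|c x y /asboolP Lx /asboolP Ly]; apply/asboolP.
    exact: submodule0.
  exact: (proj2 LP).
pose b : ideal S := HB.pack (fun v : S^o => `[< L v >])
  (GRing.isSubmodClosed.Build S S^o (fun v : S^o => `[< L v >])
    (GRing.submod_closed_semi Lclosed)).
have /finitely_generatedP := noethS b.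
apply: (@fg_transfer _ _ _ _ (fun u v => submod_val u = v)) => //.
- by move=> u v u' v' <- <-.
- by move=> c; exists c => u v <-.
- move=> u _; exists (submod_val u); split=> //.
  by apply/asboolP; exact: (submod_valP u).
- by move=> v /asboolP Lv; exists (Submod (Lv : v \in b)).
- by move=> u v <- ->.
Qed.

(** Induction on the number of generators: the coefficients at the first
    generator [g] of the elements of [N] form an ideal [L], and the elements
    of [N] with coefficient zero are generated by one vector fewer. *)
Lemma noetherian_fg_sub (V : lmodType S) (K N : V -> Prop) s :
  submodule K -> submodule N -> (forall v, N v -> gen K s v) -> fg_mod N K.
Proof.
move=> KP; elim: s N => [|g s IH] N NP Ns; first by exists [::].
have sP := gen_sub s KP.
apply: (fg_ext (K1 := gen K s)) => //; last first.
  by apply: IH => [|v []//]; apply: submoduleI.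
pose L (c : S^o) := exists v, N v /\ gen K s (v - (c : S) *: g).
have LP : submodule L.
  split=> [|c x y [v [Nv gv]] [w [Nw gw]]].
    exists 0; rewrite scale0r subrr; split; exact: submodule0.
  exists (c *: v + w); split; first exact: (proj2 NP).
  rewrite scalerDl opprD addrACA -scalerA -scalerBr.
  exact: (proj2 sP).
have := noetherian_fg_ideal LP.
apply: (fg_transfer (A := S^o) (Phi := fun c v => gen K s (v - (c : S) *: g))).
- by rewrite scale0r subrr; apply: submodule0.
- move=> c v d w cv dw.
  rewrite (_ : _ - _ = (v - (c : S) *: g) - (w - (d : S) *: g)).
    exact: submoduleB.
  by rewrite scalerBl !opprB addrACA [in RHS]addrACA [- w + _]addrC.
- move=> c; exists c => d v dv; rewrite -scalerA -scalerBr.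
  exact: submoduleZ.
- by [].
- by move=> v Nv; have [c cv] := Ns v Nv; exists c; split=> //; exists v.
- by move=> c v cv c0; rewrite c0 scale0r subr0 in cv.
Qed.

Lemma fg_mod_noetherian (V : lmodType S) (K N N' : V -> Prop) :
  submodule K -> submodule N' -> (forall v, N' v -> N v) -> fg_mod N K ->
  fg_mod N' K.
Proof.
move=> KP NP' NN' [s [_ Ns]]; apply: (noetherian_fg_sub (s := s)) => // v.
by move=> /NN'/Ns.
Qed.

End Noetherian.

(** * Complete modules *)

Section Adic.
Variables (S : comPzRingType) (r : nat) (x : 'I_r -> S).

(** With [b] the ideal generated by the [x i], this is [b^n N].  The generators
    are kept explicit, so that an element of [b^(n+1) N] comes with
    coordinates in [b^n N]. *)
Fixpoint adic_of (V : lmodType S) (N : V -> Prop) (n : nat) : V -> Prop :=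
  if n is m.+1 then
    fun v => exists w : 'I_r -> V, (forall i, adic_of N m (w i)) /\
      v = \sum_i x i *: w i
  else N.

Notation adic := (adic_of (fun _ => True)).

Lemma adic_submodule (V : lmodType S) n : submodule (fun v : V => adic n v).
Proof.
elim: n => [|n IH] //=; split.
  exists (fun=> 0); split=> [i|]; first exact: (submodule0 IH).
  by rewrite big1 // => i _; rewrite scaler0.
move=> c _ _ [v [vn ->]] [w [wn ->]].
exists (fun i => c *: v i + w i); split=> [i|]; first exact: (proj2 IH).
rewrite scaler_sumr -big_split; apply: eq_bigr => i _ /=.
by rewrite scalerDr !scalerA mulrC.
Qed.

Lemma adic_linear (V W : lmodType S) (f : {linear V -> W}) n v :
  adic n v -> adic n (f v).
Proof.
elim: n v => [|n IH] v //= [w [wn ->]].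
exists (fun i => f (w i)); split=> [i|]; first exact: IH.
by rewrite linear_sum; apply: eq_bigr => i _; rewrite linearZ.
Qed.

Lemma adicS (V : lmodType S) n (v : V) i : adic n v -> adic n.+1 (x i *: v).
Proof.
move=> vn; exists (fun j => if j == i then v else 0); split=> [j|].
  by case: ifP => // _; exact: (submodule0 (adic_submodule V n)).
by rewrite (bigD1 i) //= eqxx big1 ?addr0 // => j /negbTE->; rewrite scaler0.
Qed.

Lemma adic_sum (V : lmodType S) n (w : 'I_r -> V) :
  (forall i, adic n (w i)) -> adic n.+1 (\sum_i x i *: w i).
Proof. by move=> wn; exists w. Qed.

Definition separated (V : lmodType S) :=
  forall v : V, (forall n, adic n v) -> v = 0.

(** Convergence is stated for series whose terms tend to zero at the standard
    rate; the limit is unique by separatedness. *)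
Definition complete (V : lmodType S) :=
  separated V /\
  forall u : nat -> V, (forall n, adic n (u n)) ->
    exists s, forall n, adic n (s - \sum_(k < n) u k).

(** Successive approximation: write [y = f u_0 + y_1] with [y_1] in [bN], then
    [y_1 = f u_1 + y_2] with [u_1] in [bA] and [y_2] in [b^2 N], and so on;
    the sum of the [u_n] is a preimage of [y].  The submodule [N] is arbitrary
    because the proof of noetherianity applies this to an ideal that is not
    known to be complete. *)
Lemma complete_nakayama (A B : lmodType S) (f : {linear A -> B})
    (N : B -> Prop) :
  complete A -> separated B ->
  (forall y, N y -> exists u w, (forall i, N (w i)) /\
     y = f u + \sum_(i < r) x i *: w i) ->
  forall y, N y -> exists u, y = f u.
Proof.
move=> [_ convA] sepB step.
have {}step n z : adic_of N n z ->
    exists u, adic n u /\ adic_of N n.+1 (z - f u).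
  elim: n z => [|n IH] z.
    move=> /step[u [w [wN ->]]]; exists u; split=> //.
    by exists w; rewrite addrC addKr.
  move=> [w [wN ->]]; have [u uP] := choice (fun i => IH _ (wN i)).
  exists (\sum_i x i *: u i); split.
    by apply: adic_sum => i; case: (uP i).
  exists (fun i => w i - f (u i)); split=> [i|]; first by case: (uP i).
  rewrite linear_sum -sumrB; apply: eq_bigr => i _.
  by rewrite linearZ scalerBr.
have adicN n z : adic_of N n z -> adic n z.
  elim: n z => [|n IH] z //= [w [wN ->]].
  by exists w; split=> // i; apply: IH.
move=> y Ny.
(* The choice is made uniformly for all pairs, so that the sequence of errors
   can be defined by plain recursion. *)
have /choice[F FP] (p : nat * B) : exists u, adic_of N p.1 p.2 ->
    adic p.1 u /\ adic_of N p.1.+1 (p.2 - f u).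
  have [/step[u uP]|nN] := pselect (adic_of N p.1 p.2); last by exists 0.
  by exists u.
pose ys := fix ys n := if n is m.+1 then ys m - f (F (m, ys m)) else y.
have ysP n : adic_of N n (ys n).
  by elim: n => [|n IH] //; apply: (proj2 (FP (n, ys n) IH)).
have [s sP] := convA (fun n => F (n, ys n))
  (fun n => proj1 (FP (n, ys n) (ysP n))).
exists s; apply/eqP; rewrite -subr_eq0; apply/eqP/sepB => n.
have -> : y - f s = ys n - f (s - \sum_(k < n) F (k : nat, ys k)).
  rewrite linearB opprB addrA [LHS]addrC [RHS]addrC; congr (_ + _).
  elim: n {sP} => [|n IH]; first by rewrite big_ord0 linear0 addr0.
  by rewrite big_ord_recr linearD /= addrACA addrA subrK.
apply: submoduleB; first exact: adic_submodule; first exact: adicN.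
exact: adic_linear.
Qed.

Lemma complete_surj (A B : lmodType S) (f : {linear A -> B}) :
  complete A -> separated B ->
  (forall y, exists u, adic 1 (y - f u)) -> forall y, exists u, y = f u.
Proof.
move=> compA sepB step y.
apply: (complete_nakayama (N := fun _ => True) compA sepB _ I) => {}y _.
have [u [w [_ wP]]] := step y; exists u, w; split=> //.
by rewrite -wP addrC subrK.
Qed.

(** Projectivity relative to surjections between complete modules. *)
Definition liftable (V : lmodType S) :=
  forall (A B : lmodType S) (g : {linear A -> B}) (f : {linear V -> B}),
    complete A -> complete B -> (forall b, exists a, g a = b) ->
    exists h : {linear V -> A}, forall v, g (h v) = f v.

Definition complete_projective V := complete V /\ liftable V.

Lemma cproj_retract (V W : lmodType S) (i : {linear V -> W})
    (p : {linear W -> V}) :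
  (forall v, p (i v) = v) -> complete_projective W -> complete_projective V.
Proof.
move=> ipK [[sepW convW] liftW]; split; first split=> [v vn|u un].
- by rewrite -[v]ipK [i v]sepW ?linear0 // => n; apply/adic_linear/vn.
- have [n|s sP] := convW (fun n => i (u n)); first exact/adic_linear/un.
  exists (p s) => n.
  rewrite (_ : _ - _ = p (s - \sum_(k < n) i (u k))); last first.
    by rewrite linearB (linear_sum p); congr (_ - _); apply: eq_bigr.
  exact/adic_linear/sP.
- move=> A B g f compA compB gB.
  have [h hP] := liftW A B g (f \o p) compA compB gB.
  by exists (h \o i) => v; rewrite /= hP /= ipK.
Qed.

Lemma cproj_prod (V W : lmodType S) : complete_projective V ->
  complete_projective W -> complete_projective (V * W)%type.
Proof.
move=> [[sepV convV] liftV] [[sepW convW] liftW].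
have fst_lin : linear (@fst V W) by [].
have snd_lin : linear (@snd V W) by [].
pose f1 : {linear (V * W)%type -> V} := mk_linear fst_lin.
pose f2 : {linear (V * W)%type -> W} := mk_linear snd_lin.
have in1_lin : linear (fun v : V => (v, 0 : W)).
  by move=> c v w; congr pair; rewrite /= scaler0 addr0.
have in2_lin : linear (fun w : W => (0 : V, w)).
  by move=> c v w; congr pair; rewrite /= scaler0 addr0.
pose i1 : {linear V -> (V * W)%type} := mk_linear in1_lin.
pose i2 : {linear W -> (V * W)%type} := mk_linear in2_lin.
have split_in (z : V * W) : z = i1 z.1 + i2 z.2.
  by case: z => v w; congr pair; rewrite /= ?addr0 ?add0r.
split; first split=> [z zn|u un].
- have z1 : z.1 = 0 by apply: sepV => n; apply: (adic_linear f1 (zn n)).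
  have z2 : z.2 = 0 by apply: sepW => n; apply: (adic_linear f2 (zn n)).
  by case: z z1 z2 {zn} => v w /= -> ->.
- have [n|s sP] := convV (fun n => (u n).1); first exact: (adic_linear f1).
  have [n|t tP] := convW (fun n => (u n).2); first exact: (adic_linear f2).
  exists (s, t) => n; rewrite [_ - _]split_in.
  apply: submoduleD; first exact: adic_submodule.
    have := adic_linear i1 (sP n); congr (adic _ (i1 _)).
    by congr (_ - _); apply/esym/(linear_sum f1).
  have := adic_linear i2 (tP n); congr (adic _ (i2 _)).
  by congr (_ - _); apply/esym/(linear_sum f2).
- move=> A B g f compA compB gB.
  have [h1 h1P] := liftV A B g (f \o i1) compA compB gB.
  have [h2 h2P] := liftW A B g (f \o i2) compA compB gB.
  exists ((h1 \o f1) \+ (h2 \o f2)) => z /=.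
  by rewrite linearD h1P h2P /= -linearD -split_in.
Qed.

End Adic.
Notation adic x := (adic_of x (fun _ => True)).

Section Cover.
Variables (S : comPzRingType) (r : nat) (x : 'I_r -> S).
Hypothesis compS : complete x S^o.

Lemma cproj_ring : complete_projective x S^o.
Proof.
split=> // A B g f _ _ /(_ (f (1 : S)))[a ga].
have al : linear (fun c : S^o => (c : S) *: a).
  by move=> c u v; rewrite scalerDl scalerA.
exists (mk_linear al) => v /=; rewrite linearZ /= ga -linearZ.
by congr (f _); apply: mulr1.
Qed.

(** The module [F] is a finite free module, built as an iterated product of
    copies of the ring. *)
Lemma cproj_cover (V : lmodType S) (s : seq V) :
  exists (F : lmodType S) (f : {linear F -> V}),
  [/\ complete_projective x F, fg_mod (fun _ : F => True) (fun u => u = 0),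
      forall g, g \in s -> exists u, f u = g &
      forall u, gen (fun v => v = 0) s (f u)].
Proof.
have fgS : fg_mod (fun _ : S^o => True) (fun u => u = 0).
  by exists [:: (1 : S)]; split=> // c _; exists c;
    rewrite /= [_ *: _]mulr1 subrr.
elim: s => [|g s [F [f [goodF fgF sf fs]]]].
  have zl : linear (fun _ : S^o => 0 : V).
    by move=> c u v; rewrite scaler0 addr0.
  by exists S^o, (mk_linear zl); split=> //; apply: cproj_ring.
have hl : linear (fun u : S^o * F => (u.1 : S) *: g + f u.2).
  move=> c [a u] [b v] /=; rewrite linearP scalerDl scalerDr scalerA.
  by rewrite addrACA.
exists (S^o * F)%type, (mk_linear hl); split.
- by apply: cproj_prod => //; apply: cproj_ring.
- apply: (fg_ext (K1 := fun u => u.1 = 0)) => //.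
    apply: (fg_transfer (Phi := fun c u => u.1 = c)) fgS => //.
    + by move=> c u d v <- <-.
    + by move=> c; exists c => d u <-.
    + by move=> c _; exists (c, 0).
    + by move=> u _; exists u.1.
    + by move=> c u -> ->.
  apply: (fg_transfer (Phi := fun w u => u = (0, w))) fgF => //.
  + by move=> w _ v _ -> ->; congr pair; rewrite /= subr0.
  + by move=> c; exists c => w _ ->; congr pair; rewrite /= scaler0.
  + by move=> w _; exists (0, w).
  + by move=> [c w] [_ /= ->]; exists w.
  + by move=> w _ -> ->.
- move=> h; rewrite inE => /orP[/eqP->|/sf[u <-]].
    by exists (1 : S, 0); rewrite /= scale1r linear0 addr0.
  by exists (0, u); rewrite /= scale0r add0r.
- by move=> [c u]; exists c; rewrite /= addrC addKr.
Qed.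

End Cover.

(** * A complete ring is noetherian if its residue ring is *)

Section Hilbert.
Variables (S : comPzRingType).
Implicit Types (N : S^o -> Prop) (t : S).

Notation fg N := (fg_mod N (fun v => v = 0)).

Lemma colon_submodule N t :
  submodule N -> submodule (fun p : S^o => N (t *: p)).
Proof.
move=> NP; split=> [|c p q Np Nq]; first by rewrite scaler0; apply: submodule0.
rewrite scalerDr scalerA mulrC -scalerA; exact: (proj2 NP).
Qed.

(** Since [N / (N /\ tS)] is [(N + tS) / tS]. *)
Lemma fg_mod_of_sum N t : submodule N ->
  fg (fun p => exists q : S^o, N (p - t *: q)) ->
  fg_mod N (fun p => exists q : S^o, p = t *: q).
Proof.
move=> NP.
apply: (fg_transfer (Phi := fun p n => exists q : S^o, p - n = t *: q)).
- by exists 0; rewrite subrr scaler0.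
- move=> p n p' n' [q qP] [q' qP']; exists (q - q').
  by rewrite scalerBr -qP -qP' !opprB addrACA [in RHS]addrACA [- p' + _]addrC.
- move=> c; exists c => p n [q qP]; exists (c *: q).
  by rewrite -scalerBr qP !scalerA mulrC.
- by move=> p [q Nq]; exists (p - t *: q); split=> //; exists q; rewrite subKr.
- move=> n Nn; exists n; split; last by exists 0; rewrite subrr scaler0.
  by exists 0; rewrite scaler0 subr0.
- move=> p n [q qP] p0; exists (- q).
  by rewrite scalerN -qP p0 sub0r opprK.
Qed.

(** Multiplication by [t] maps the colon ideal [N : t] onto [N /\ tS]. *)
Lemma fg_of_colon N t : submodule N ->
  fg (fun p => exists q : S^o, N (p - t *: q)) -> fg (fun p => N (t *: p)) ->
  fg N.
Proof.
move=> NP /(fg_mod_of_sum NP) fgs fgc; apply: fg_ext fgs _ => //.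
apply: (fg_transfer (Phi := fun p n => n = t *: p)) fgc.
- by rewrite scaler0.
- by move=> p _ q _ -> ->; rewrite scalerBr.
- by move=> c; exists c => p _ ->; rewrite !scalerA mulrC.
- by move=> p Np; exists (t *: p); do 2?split=> //; exists p.
- by move=> n [Nn [q nq]]; exists q; rewrite -nq.
- by move=> p n -> ->; rewrite scaler0.
Qed.

Lemma fg_sum_of_above N t : submodule N ->
  (forall N', submodule N' -> (forall p, N p -> N' p) -> N' t -> fg N') ->
  fg (fun p => exists q : S^o, N (p - t *: q)).
Proof.
move=> NP; apply.
- split=> [|c p p' [q Nq] [q' Nq']].
    by exists 0; rewrite scaler0 subr0; apply: submodule0.
  exists (c *: q + q'); rewrite scalerDr opprD addrACA.
  by rewrite scalerA [t * c]mulrC -scalerA -scalerBr; apply: (proj2 NP).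
- by move=> p Np; exists 0; rewrite scaler0 subr0.
- by exists (1 : S); rewrite [_ *: _]mulr1 subrr; apply: submodule0.
Qed.

(** Descent along the chain of colon ideals from [N : t^n] to [N]. *)
Lemma fg_of_colonX N t n : submodule N ->
  (forall N', submodule N' -> (forall p, N p -> N' p) -> N' t -> fg N') ->
  fg (fun p => N (t ^+ n *: p)) -> fg N.
Proof.
elim: n N => [|n IH] N NP NH fgn.
  by apply: fg_mod_eq fgn => p; rewrite expr0 scale1r.
apply: (@fg_of_colon N t) => //; first exact: fg_sum_of_above.
apply: IH => [|N' NP' NN' N't|].
- exact: colon_submodule.
- by apply: NH => // p Np; apply: NN'; apply: submoduleZ.
- by apply: fg_mod_eq fgn => p; rewrite scalerA -exprS.
Qed.

Variables (r : nat) (x : 'I_r -> S).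
Hypothesis compS : complete x S^o.

(** If [p = sum + t q] lies in a [t]-saturated ideal [N], the sum being a
    combination of generators of [N] modulo [t], then [q] lies in [N] as well.
    So [N = (span of the generators) + tN], and Nakayama applies. *)
Lemma fg_of_saturated N i : submodule N ->
  (forall p : S^o, N (x i *: p) -> N p) ->
  fg (fun p => exists q : S^o, N (p - x i *: q)) -> fg N.
Proof.
move=> NP satN /(fg_mod_of_sum NP)[s [sN Ns]]; exists s; split=> // p Np.
have [F [f [[compF _] _ sf fs]]] := cproj_cover compS s.
suff [u ->] : exists u, p = f u by exact: fs.
apply: (complete_nakayama compF (proj1 compS) _ Np) => {p Np} p Np.
have : exists u, exists q : S^o, p - f u = x i *: q.
  have := Ns p Np; elim: s sf {sN Ns fs} p {Np} => [|g s IH] sf p /=.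
    by move=> [q ->]; exists 0, q; rewrite linear0 subr0.
  move=> [c /IH[|u [q uq]]].
    by move=> h hs; apply: sf; rewrite inE hs orbT.
  have [v vg] := sf g (mem_head _ _).
  by exists (c *: v + u), q; rewrite linearP vg opprD addrA.
move=> [u [q uq]]; exists u, (fun j => if j == i then q else 0); split=> [j|].
  case: ifP => _; last exact: submodule0.
  apply: satN; rewrite -uq; apply: submoduleB => //.
  by apply: gen_min sN _ (fs u) => // v ->; apply: submodule0.
rewrite (bigD1 i) //= eqxx big1 => [|j /negbTE->]; last by rewrite scaler0.
by rewrite addr0 -uq addrC subrK.
Qed.

(** The saturation [Ni] of [N] with respect to [t] is finitely generated, hence
    equal to the colon ideal [N : t^n] for a single [n]; then descend to
    [N]. *)
Lemma fg_of_element N i : submodule N ->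
  (forall N', submodule N' -> (forall p, N p -> N' p) -> N' (x i) -> fg N') ->
  fg N.
Proof.
move=> NP NH; set t := x i in NH *.
pose Ni (p : S^o) := exists n, N (t ^+ n *: p).
have Nmono n m (p : S^o) : N (t ^+ n *: p) -> N (t ^+ (m + n) *: p).
  by move=> Np; rewrite exprD -scalerA; apply: submoduleZ.
have NiP : submodule Ni.
  split=> [|c p q [n Np] [m Nq]].
    by exists 0%N; rewrite scaler0; apply: submodule0.
  exists (m + n)%N; rewrite scalerDr scalerA mulrC -scalerA.
  by apply: (proj2 NP); [apply: Nmono|rewrite addnC; apply: Nmono].
have fgNi : fg Ni.
  apply: (@fg_of_saturated Ni i) => // [p [n Np]|].
    by exists n.+1; rewrite exprSr -scalerA.
  apply: fg_sum_of_above => // N' NP' NN' N't; apply: NH => // p Np.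
  by apply: NN'; exists 0%N; rewrite scale1r.
have [s [sN Ns]] := fgNi.
have [n nP] : exists n, forall g, g \in s -> N (t ^+ n *: g).
  elim: s sN {Ns} => [|g s IH] sN; first by exists 0%N.
  have [m mP] : exists m, forall g, g \in s -> N (t ^+ m *: g).
    by apply: IH => h hs; apply: sN; rewrite inE hs orbT.
  have [n nP] := sN g (mem_head _ _); exists (m + n)%N => h.
  rewrite inE => /orP[/eqP->|/mP]; first exact: Nmono.
  by rewrite addnC; apply: Nmono.
apply: (@fg_of_colonX N t n) => //; apply: fg_mod_eq fgNi => p.
split=> [/Ns sp|]; last by exists n.
apply: gen_min nP _ sp; first exact: colon_submodule.
by move=> v ->; rewrite scaler0; apply: submodule0.
Qed.

(** Induction on [k], the number of leading [x i] that the ideal may fail to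
    contain. *)
Theorem complete_noetherian :
  (forall N, submodule N -> (forall i, N (x i)) -> fg N) -> noetherian S.
Proof.
move=> baseN.
have fgN k N : submodule N -> (forall i : 'I_r, (k <= i)%N -> N (x i)) -> fg N.
  elim: k N => [|k IH] N NP Nx; first by apply: baseN => // i; apply: Nx.
  have [kr|rk] := ltnP k r; last first.
    by apply: IH => // i ki; have := leq_trans rk ki; rewrite leqNgt ltn_ord.
  apply: (@fg_of_element N (Ordinal kr)) => // N' NP' NN' N'x.
  apply: IH => // i; rewrite leq_eqVlt => /orP[/eqP ki|/Nx/NN' //].
  by rewrite (_ : i = Ordinal kr) //; apply: val_inj.
move=> b; apply/finitely_generatedP.
have : fg (fun p : S^o => p \in b).
  apply: (fgN r) => [|i]; last by rewrite leqNgt ltn_ord.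
  by split=> [|c p q]; [apply: submod0|apply: submodP].
apply: (fg_transfer (Phi := fun v u => submod_val u = v)) => //.
- by move=> u v u' v' <- <-.
- by move=> c; exists c => u v <-.
- by move=> p bp; exists (Submod bp).
- by move=> u _; exists (submod_val u); split=> //; apply: submod_valP.
- by move=> p u up p0; apply: val_inj; rewrite /= up p0.
Qed.

End Hilbert.

(** * Homology relative to a family of submodules *)

(** Finite generation of the homology of [C / I] for a family of submodules
    [I], expressed in [C] itself.  The family [I = 0] gives the homology of
    [C], and [I = bC] that of [C / bC]. *)
Section RelativeHomology.
Variables (S : pzRingType) (C : complex S) (I : forall n, C n -> Prop).

Definition rel_cycle n : C n -> Prop :=
  if n is m.+1 then fun z => I (cdiff C m z) else fun=> True.

Definition rel_boundary n (z : C n) := exists y, I (z - cdiff C n y).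

Definition fg_homology n := fg_mod (@rel_cycle n) (@rel_boundary n).

End RelativeHomology.

Lemma homology_fg (S : pzRingType) (C : complex S) n :
  finitely_generated (homology C n) <->
  fg_homology (fun n (v : C n) => v = 0) n.
Proof.
have cycP (z : C n) : z \in cycles (n := n) <-> rel_cycle (fun n v => v = 0) z.
  by case: n z => [|n] z //=; split=> [/eqP|/eqP].
rewrite finitely_generatedP.
apply: (fg_correspondence (Phi := fun h z => exists zz : submod (@cycles S C n),
  h = quot_proj _ zz /\ submod_val zz = z)).
- by exists 0; rewrite linear0.
- move=> _ _ _ _ [z [-> <-]] [w [-> <-]].
  by exists (z - w); rewrite linearB.
- by move=> c _ _ [z [-> <-]]; exists (c *: z); rewrite linearZ.
- move=> h _; exists (submod_val (repr h)); split.
    by apply/cycP/submod_valP.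
  by exists (repr h); rewrite quot_reprK.
- move=> z /cycP zP; exists (quot_proj _ (Submod zP)); split=> //.
  by exists (Submod zP).
- move=> _ _ [z [-> <-]].
  have -> : quot_proj (@boundaries S C n) z = 0 <-> z \in @boundaries S C n.
    by rewrite -[z in X in _ <-> X]subr0 -quot_projP linear0.
  split=> [/asboolP[y ->]|[y /eqP]]; first by exists y; rewrite subrr.
  by rewrite subr_eq0 => /eqP zy; apply/asboolP; exists y.
Qed.

(** If a linear correspondence induces an isomorphism from [A / IA] to
    [B / IB], then the relative homologies agree.  This is used for
    [P -> R/a (x) P] and for [P -> completion P], and in both directions. *)
Lemma fg_homology_transfer (R S : pzRingType) (A : complex R) (B : complex S)
    (IA : forall n, A n -> Prop) (IB : forall n, B n -> Prop)
    (Phi : forall n, A n -> B n -> Prop) (n : nat) :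
  (forall n, Phi n 0 0) ->
  (forall n a b a' b', Phi n a b -> Phi n a' b' -> Phi n (a - a') (b - b')) ->
  (forall c, exists c', forall n a b, Phi n a b -> Phi n (c *: a) (c' *: b)) ->
  (forall n a, exists b, Phi n a b) -> (forall n b, exists a, Phi n a b) ->
  (forall n a b, Phi n.+1 a b -> Phi n (cdiff A n a) (cdiff B n b)) ->
  (forall n a b, Phi n a b -> IA n a <-> IB n b) ->
  fg_homology IA n -> fg_homology IB n.
Proof.
move=> Phi0 PhiB PhiZ PhiAB PhiBA Phid PhiI.
have cyc a b : Phi n a b -> rel_cycle IA a <-> rel_cycle IB b.
  by case: n a b => [|n] a b //= /Phid/PhiI.
apply: (fg_transfer (Phi := Phi n)) => //; first exact: PhiB.
- by move=> c; have [c' cP] := PhiZ c; exists c'; apply: cP.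
- move=> a /= ca; have [b ab] := PhiAB n a.
  by exists b; split; first exact/(cyc a).
- move=> b /= cb; have [a ab] := PhiBA n b.
  by exists a; split; first exact/(cyc a b).
- move=> a b ab [y ya]; have [z yz] := PhiAB _ y; exists z.
  by apply/(PhiI n (a - cdiff A n y)) => //; apply: PhiB => //; apply: Phid.
Qed.

(** * Dimension shifting *)

Section Shift.
Variables (S : comPzRingType) (C : complex S) (F : lmodType S).
Variable (f0 : {linear F -> C 0%N}).

(** When this map is onto, its kernel followed by [C 2], [C 3], .. is a complex
    whose homology is that of [C] shifted by one degree, up to a contribution
    of [F] in degree [0]. *)
Definition cover_map (u : F * C 1%N) : C 0%N := f0 u.1 + cdiff C 0%N u.2.
Fact cover_map_linear : linear cover_map.
Proof.
move=> c [u v] [u' v'] /=; rewrite /cover_map /= !linearP.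
by rewrite scalerDr addrACA.
Qed.
HB.instance Definition _ := GRing.isLinear.Build S (F * C 1%N)%type (C 0%N) *:%R
  cover_map cover_map_linear.

Definition shift_obj n : lmodType S :=
  if n is m.+1 then C m.+2 else submod (lker_pred cover_map).

Fact shift_diff0_subproof (y : C 2%N) :
  ((0, cdiff C 1%N y) : F * C 1%N) \in lker_pred cover_map.
Proof.
have fy : f0 0 + cdiff C 0%N (cdiff C 1%N y) = 0.
  by rewrite cdiffK linear0 addr0.
exact/eqP.
Qed.
Definition shift_diff0 (y : C 2%N) : shift_obj 0 :=
  Submod (shift_diff0_subproof y).
Fact shift_diff0_linear : linear shift_diff0.
Proof.
move=> c y z; apply: val_inj; rewrite /= linearP.
by congr pair; rewrite /= scaler0 addr0.
Qed.

Definition shift_diff n : {linear shift_obj n.+1 -> shift_obj n} :=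
  if n is m.+1 then cdiff C m.+2 else mk_linear shift_diff0_linear.

Fact shift_diffK n y : shift_diff n (shift_diff n.+1 y) = 0.
Proof.
case: n y => [|n] y /=; last exact: cdiffK.
by apply: val_inj; rewrite /= cdiffK.
Qed.

Definition shift : complex S := Complex shift_diffK.

End Shift.

Section Retraction.
Variables (S : comPzRingType) (C : complex S) (F : lmodType S).
Variables (f0 : {linear F -> C 0%N}) (sec : {linear C 0%N -> (F * C 1%N)%type}).
Hypothesis secK : forall z, cover_map f0 (sec z) = z.

Fact retraction_subproof w :
  w - sec (cover_map f0 w) \in lker_pred (cover_map f0).
Proof. by apply/eqP; rewrite linearB /= secK subrr. Qed.
Definition retraction_fun w := Submod (retraction_subproof w).
Fact retraction_linear : linear retraction_fun.
Proof.
move=> c v w; apply: val_inj; rewrite /= (linearP (cover_map f0)) (linearP sec).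
by rewrite scalerBr opprD addrACA.
Qed.
Definition retraction := mk_linear retraction_linear.

Lemma retractionK w : retraction (submod_val w) = w.
Proof.
apply: val_inj => /=; have /eqP := submod_valP w => /= ->.
by rewrite linear0 subr0.
Qed.

End Retraction.

(** [I] is a preradical: a choice of submodules preserved by all linear maps,
    so that a direct summand [W] of [V] satisfies [I W = W /\ I V].  This is
    why a section of [cover_map] gives control of the kernel modulo [I]. *)
Section ShiftHomology.
Variables (S : comPzRingType) (C : complex S) (F : lmodType S).
Variable (f0 : {linear F -> C 0%N}) (I : forall V : lmodType S, V -> Prop).
Arguments I {V}.
Hypothesis I_sub : forall V : lmodType S, submodule (@I V).
Hypothesis I_lin : forall (V W : lmodType S) (f : {linear V -> W}) v,
  I v -> I (f v).
Hypothesis noethS : noetherian S.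
Hypothesis fgF : fg_mod (fun _ : F => True) (fun u => u = 0).
Variable sec : {linear C 0%N -> (F * C 1%N)%type}.
Hypothesis secK : forall z, cover_map f0 (sec z) = z.

Let FC : lmodType S := (F * C 1%N)%type.
Let K0 : lmodType S := submod (lker_pred (cover_map f0)).
Let fst_lin : linear (@fst F (C 1%N)). Proof. by []. Qed.
Let pr1 : {linear FC -> F} := mk_linear fst_lin.
Let snd_lin : linear (@snd F (C 1%N)). Proof. by []. Qed.
Let pr2 : {linear FC -> C 1%N} := mk_linear snd_lin.
Let inr_lin : linear (fun v => (0, v) : FC).
Proof. by move=> c v w; congr pair; rewrite /= scaler0 addr0. Qed.
Let inr : {linear C 1%N -> FC} := mk_linear inr_lin.
Let inl_lin : linear (fun u => (u, 0) : FC).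
Proof. by move=> c v w; congr pair; rewrite /= scaler0 addr0. Qed.
Let inl : {linear F -> FC} := mk_linear inl_lin.
Let val_lin : linear (fun w : K0 => submod_val w : FC). Proof. by []. Qed.
Let inK : {linear K0 -> FC} := mk_linear val_lin.

Let ret : {linear FC -> K0} := retraction secK.

Let inKK w : ret (inK w) = w. Proof. exact: retractionK. Qed.

Let I_inK w : I (inK w) <-> I w.
Proof. by split=> [/(I_lin ret)|/(I_lin inK)//]; rewrite inKK. Qed.

(* [T / K] is both the homology of the shifted complex in degree 0, because
   [T] is the kernel of [cover_map] plus [I], and an extension of a submodule of
   [F / I F] by the homology of [C] in degree 1. *)
Let T (w : FC) := I (cover_map f0 w).
Let K (w : FC) := exists y, I (w - inr (cdiff C 1%N y)).

Let T_sub : submodule T.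
Proof.
split=> [|c v w Tv Tw]; first by rewrite /T linear0; apply: submodule0.
by rewrite /T linearP; apply: (proj2 (I_sub _)).
Qed.

Let K_sub : submodule K.
Proof.
split=> [|c v w [y Ky] [z Kz]].
  by exists 0; rewrite (linear0 (cdiff C 1%N)) (linear0 inr) subr0;
    apply: submodule0.
exists (c *: y + z); rewrite (linearP (cdiff C 1%N)) (linearP inr).
by rewrite opprD addrACA -scalerBr; apply: (proj2 (I_sub _)).
Qed.

Let fg_shift0 : fg_homology (fun n => @I (shift f0 n)) 0 <-> fg_mod T K.
Proof.
pose Phi (u : K0) (w : FC) := I (w - inK u).
have Phi0 : Phi 0 0 by rewrite /Phi (linear0 inK) subr0; apply: submodule0.
have PhiB u w u' w' : Phi u w -> Phi u' w' -> Phi (u - u') (w - w').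
  move=> uw uw'; rewrite /Phi (_ : _ - _ = (w - inK u) - (w' - inK u')).
    exact: submoduleB.
  by rewrite (linearB inK) !opprB addrACA [in RHS]addrACA [- w' + _]addrC.
have PhiZ c u w : Phi u w -> Phi (c *: u) (c *: w).
  by move=> uw; rewrite /Phi (linearZ_LR inK) -scalerBr; apply: submoduleZ.
have toT (u : K0) : T (inK u).
  have /eqP uP := submod_valP u.
  by rewrite /T [cover_map _ _]uP; apply: submodule0.
have toK w : T w -> Phi (ret w) w.
  by move=> Tw; rewrite /Phi /= subKr; apply: I_lin.
have PhiK u w : Phi u w -> (K w <-> exists y, I (u - shift_diff0 f0 y)).
  move=> uw; have E y : I (inK u - inr (cdiff C 1%N y)) <->
      I (u - shift_diff0 f0 y) by rewrite -I_inK linearB.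
  split=> [[y Ky]|[y /E Ky]]; exists y.
    apply/E; rewrite -[inK u](subKr w) addrAC.
    exact: submoduleB.
  by rewrite -[w](subrK (inK u)) -addrA; apply: submoduleD.
apply: (fg_correspondence (Phi := Phi)) => // [u _|w Tw|u w uw].
- by exists (inK u); split=> //; rewrite /Phi subrr; apply: submodule0.
- by exists (ret w); split=> //; apply: toK.
- by apply: iff_sym; apply: PhiK.
Qed.

Let fg_Z1 : fg_homology (fun n => @I (C n)) 1 <->
  fg_mod (fun w => T w /\ I (pr1 w)) K.
Proof.
pose Phi (w : FC) (v : C 1%N) := I (w - inr v).
have Phi0 : Phi 0 0 by rewrite /Phi (linear0 inr) subr0; apply: submodule0.
have PhiB u w u' w' : Phi u w -> Phi u' w' -> Phi (u - u') (w - w').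
  move=> uw uw'; rewrite /Phi (_ : _ - _ = (u - inr w) - (u' - inr w')).
    exact: submoduleB.
  by rewrite (linearB inr) !opprB addrACA [in RHS]addrACA [- u' + _]addrC.
have PhiZ c u w : Phi u w -> Phi (c *: u) (c *: w).
  by move=> uw; rewrite /Phi (linearZ_LR inr) -scalerBr; apply: submoduleZ.
have AB w : T w /\ I (pr1 w) -> I (cdiff C 0%N (pr2 w)) /\ Phi w (pr2 w).
  move=> [Tw Iw]; have E : w = inl (pr1 w) + inr (pr2 w).
    by case: w {Tw Iw} => u v; congr pair; rewrite /= ?addr0 ?add0r.
  split; last by rewrite /Phi {1}E addrK; apply: I_lin.
  rewrite (_ : cdiff C _ _ = cover_map f0 w - f0 (pr1 w)).
    by apply: submoduleB => //; apply: I_lin.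
  by rewrite /cover_map addrC addKr.
have BA v : I (cdiff C 0%N v) ->
    (T (inr v) /\ I (pr1 (inr v))) /\ Phi (inr v) v.
  move=> Iv; split; last by rewrite /Phi subrr; apply: submodule0.
  split; last exact: submodule0.
  by rewrite /T /cover_map /= linear0 add0r.
have PhiK w v : Phi w v -> (K w <-> exists y, I (v - cdiff C 1%N y)).
  move=> wv; have E y : I (inr v - inr (cdiff C 1%N y)) <->
      I (v - cdiff C 1%N y).
    by rewrite -linearB; split=> [/(I_lin pr2)|/(I_lin inr)].
  split=> [[y Ky]|[y /E Ky]]; exists y.
    apply/E; rewrite -[inr v](subKr w) addrAC.
    exact: submoduleB.
  by rewrite -[w](subrK (inr v)) -addrA; apply: submoduleD.
apply: iff_sym; apply: (fg_correspondence (Phi := Phi)) => // [w /AB|v /BA].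
  by exists (pr2 w).
by exists (inr v).
Qed.

(** Submodules of finitely generated modules are finitely generated: this
    gives one direction for the submodule [H_1(C)] of [T / K], and for the
    other one the finite generation of the quotient, which embeds into
    [F / I F]. *)
Lemma shift_homology0 : fg_homology (fun n => @I (shift f0 n)) 0 <->
  fg_homology (fun n => @I (C n)) 1.
Proof.
rewrite fg_shift0 fg_Z1; split.
  apply: fg_mod_noetherian => // [|w []//].
  split=> [|c v w [Tv Iv] [Tw Iw]].
    by split; [apply: (submodule0 T_sub)|rewrite linear0; apply: submodule0].
  split; first exact: (proj2 T_sub).
  by rewrite linearP; apply: (proj2 (I_sub _)).
apply: (fg_ext (K1 := fun w => I (pr1 w))) => //.
have : fg_mod (fun u : F => exists w, T w /\ pr1 w = u) (fun u => u = 0).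
  apply: fg_mod_noetherian fgF => //; first exact: submodule_eq0.
  split=> [|c _ _ [v [Tv <-]] [w [Tw <-]]].
    by exists 0; split; [apply: (submodule0 T_sub)|].
  by exists (c *: v + w); split; [apply: (proj2 T_sub)|].
apply: (fg_transfer (Phi := fun u w => pr1 w = u)) => //.
- by move=> u w u' w' <- <-; rewrite linearB.
- by move=> c; exists c => u w <-; rewrite linearZ.
- by move=> w Tw; exists (pr1 w); split=> //; exists w.
- by move=> u w uw u0; rewrite uw u0; apply: submodule0.
Qed.

Lemma shift_homologyS n : fg_homology (fun n => @I (shift f0 n)) n.+1 <->
  fg_homology (fun n => @I (C n)) n.+2.
Proof.
case: n => [|n] //; rewrite /fg_homology /=.
have E (z : C 2%N) : I (shift_diff0 f0 z) <-> I (cdiff C 1%N z).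
  rewrite -I_inK; split=> [/(I_lin pr2)//|/(I_lin inr)//].
by split; apply: fg_mod_eq => z; rewrite E.
Qed.

End ShiftHomology.

(** * Finite generation of homology and of homology modulo the ideal *)

Section CompleteComplexes.
Variables (S : comPzRingType) (r : nat) (x : 'I_r -> S).
Hypothesis compS : complete x S^o.
Hypothesis noethS : noetherian S.

(** Generators of [C 0] modulo [b] and boundaries define [F], and the map from
    [F * C 1] is surjective modulo [b], hence surjective by Nakayama. *)
Lemma fg_homology0_cover (C : complex S) :
  complete_projective x (C 1%N) -> complete_projective x (C 0%N) ->
  fg_homology (fun n (v : C n) => adic x 1 v) 0 ->
  exists (F : lmodType S) (f0 : {linear F -> C 0%N}),
    [/\ complete_projective x F, fg_mod (fun _ : F => True) (fun u => u = 0) &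
        forall z, exists u, cover_map f0 u = z].
Proof.
move=> goodC1 [[sepC0 _] _] [s [_ sP]].
have [F [f0 [goodF fgF sf _]]] := cproj_cover compS s.
exists F, f0; split=> // z.
suff [u ->] : exists u, z = cover_map f0 u by exists u.
apply: (@complete_surj _ _ x (F * C 1%N)%type) => // {z}.
  exact: (proj1 (cproj_prod goodF goodC1)).
move=> z; have := sP z I.
elim: s z sf {sP} => [|g s IH] z sf /=.
  move=> [y zy]; exists (0, y).
  by rewrite /= /cover_map /= linear0 add0r.
move=> [c /IH[|[u y] uy]].
  by move=> h hs; apply: sf; rewrite inE hs orbT.
have [v vg] := sf g (mem_head _ _); exists (c *: v + u, y).
by rewrite /= /cover_map /= linearP vg -addrA opprD addrA.
Qed.

Lemma cover_fg_homology0 (C : complex S) (F : lmodType S)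
    (f0 : {linear F -> C 0%N}) :
  fg_mod (fun _ : F => True) (fun u => u = 0) ->
  (forall z, exists u, cover_map f0 u = z) ->
  fg_homology (fun n (v : C n) => v = 0) 0.
Proof.
move=> fgF surj.
apply: (fg_transfer (Phi := fun u z => exists y, z = cover_map f0 (u, y))) fgF.
- by exists 0; rewrite /cover_map !linear0 addr0.
- move=> u _ v _ [y ->] [z ->]; exists (y - z).
  by rewrite -(linearB (cover_map f0)).
- move=> c; exists c => u _ [y ->]; exists (c *: y).
  by rewrite -(linearZ_LR (cover_map f0)).
- by move=> u _; exists (cover_map f0 (u, 0)); split=> //; exists 0.
- by move=> z _; have [[u y] <-] := surj z; exists u; split=> //; exists y.
- move=> u _ [y ->] ->; exists y.
  by rewrite /cover_map /= linear0 add0r subrr.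
Qed.

Lemma cproj_shift (C : complex S) (F : lmodType S) (f0 : {linear F -> C 0%N})
    (sec : {linear C 0%N -> (F * C 1%N)%type}) :
  (forall z, cover_map f0 (sec z) = z) -> complete_projective x F ->
  (forall i, complete_projective x (C i)) ->
  forall i, complete_projective x (shift f0 i).
Proof.
move=> secK goodF goodC [|i] //=.
have val_lin : linear (fun w : submod (lker_pred (cover_map f0)) =>
    submod_val w) by [].
apply: (cproj_retract (i := mk_linear val_lin) (p := retraction secK)).
  exact: retractionK.
exact: cproj_prod.
Qed.

(** Dimension shifting.  Either side makes the homology modulo [b] in degree
    [0] finitely generated, and this is what the construction of the shifted
    complex starts from. *)
Theorem fg_homology_mod (C : complex S) (n : nat) :
  (forall i, complete_projective x (C i)) ->
  (forall i, (i <= n)%N -> fg_homology (fun i (v : C i) => v = 0) i) <->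
  (forall i, (i <= n)%N -> fg_homology (fun i (v : C i) => adic x 1 v) i).
Proof.
elim: n C => [|n IH] C goodC.
  split=> fgC i; rewrite leqn0 => /eqP->; have {}fgC := fgC 0%N (leqnn _).
    apply: fg_modS fgC => z [y zy]; exists y; rewrite zy.
    exact: (submodule0 (adic_submodule _ _ _)).
  have [F [f0 [_ fgF surj]]] := fg_homology0_cover (goodC 1%N) (goodC 0%N) fgC.
  exact: cover_fg_homology0 fgF surj.
have main : fg_homology (fun i (v : C i) => adic x 1 v) 0 ->
  (forall i, (i <= n.+1)%N -> fg_homology (fun i (v : C i) => v = 0) i) <->
  (forall i, (i <= n.+1)%N -> fg_homology (fun i (v : C i) => adic x 1 v) i).
  move=> fg0.
  have [F [f0 [goodF fgF surj]]] :=
    fg_homology0_cover (goodC 1%N) (goodC 0%N) fg0.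
  have [sec secK] : exists sec : {linear C 0%N -> (F * C 1%N)%type},
      forall z, cover_map f0 (sec z) = z.
    have [[compF _] [compC1 _]] := (goodF, goodC 1%N).
    have [compC0 liftC0] := goodC 0%N.
    apply: (liftC0 _ _ (cover_map f0) idfun) => //.
    by apply: (proj1 (cproj_prod goodF (goodC 1%N))).
  have eq0_lin (V W : lmodType S) (f : {linear V -> W}) v : v = 0 -> f v = 0.
    by move=> ->; rewrite linear0.
  have ad_lin (V W : lmodType S) (f : {linear V -> W}) (v : V) :
    adic x 1 v -> adic x 1 (f v) by apply: adic_linear.
  have ad_sub (V : lmodType S) := adic_submodule x V 1.
  have z0 := shift_homology0 (I := fun V v => v = 0)
    (fun V => @submodule_eq0 S V) eq0_lin noethS fgF secK.
  have zS := shift_homologyS (I := fun V v => v = 0) eq0_lin secK.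
  have a0 := shift_homology0 ad_sub ad_lin noethS fgF secK.
  have aS := shift_homologyS ad_lin secK.
  have shiftE (J : forall V : lmodType S, V -> Prop) :
      fg_homology (fun n (v : C n) => J _ v) 0 ->
      (fg_homology (fun n (v : shift f0 n) => J _ v) 0 <->
        fg_homology (fun n (v : C n) => J _ v) 1) ->
      (forall n, fg_homology (fun n (v : shift f0 n) => J _ v) n.+1 <->
        fg_homology (fun n (v : C n) => J _ v) n.+2) ->
      (forall i, (i <= n.+1)%N -> fg_homology (fun i (v : C i) => J _ v) i) <->
      (forall i, (i <= n)%N ->
        fg_homology (fun i (v : shift f0 i) => J _ v) i).
    move=> J0 J1 JS; split=> fgC [|i] lei.
    - exact/J1/fgC.
    - exact/JS/fgC.
    - exact: J0.
    - by case: i lei => [|i] lei; [exact/J1/fgC|exact/JS/fgC].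
  rewrite (shiftE (fun V v => v = 0)) // ?(shiftE (fun V v => adic x 1 v)) //.
    exact: (IH (shift f0) (cproj_shift secK goodF goodC)).
  exact: cover_fg_homology0 fgF surj.
split=> fgC; apply/main => //; last exact: fgC.
apply: fg_modS (fgC 0%N isT) => z [y zy]; exists y; rewrite zy.
exact: (submodule0 (adic_submodule _ _ _)).
Qed.

End CompleteComplexes.

(** * Completions *)

Lemma span_ind (R : pzRingType) (V : lmodType R) (E N : V -> Prop) :
  submodule N -> (forall v, E v -> N v) -> forall v, v \in Defs.span E -> N v.
Proof.
move=> NP EN v /asboolP[s [sE ->]]; elim: s sE => [|p s IH] sE.
  by rewrite big_nil; apply: submodule0.
rewrite big_cons; apply: (proj2 NP); first by apply/EN/sE/mem_head.
by apply: IH => q qs; apply: sE; rewrite inE qs orbT.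
Qed.

Section AdicSubmod.
Variables (R : comPzRingType) (a : ideal R) (r : nat) (x : 'I_r -> R).
Hypothesis xa : forall i, (x i : R^o) \in a.
Hypothesis ax : forall s : R^o, s \in a -> exists c : 'I_r -> R,
  s = \sum_i c i * x i.

(** The powers of [a] are defined through spans of products; with generators
    of [a] at hand they can be computed with coordinates. *)
Lemma adic_submodP (V : lmodType R) n (v : V) :
  v \in adic_submod a V n <-> adic x n v.
Proof.
split.
  apply: span_ind; first exact: adic_submodule.
  move=> _ [s [y [sn _ ->]]].
  elim: n s sn y => [|n IH] s //= sn y.
  have H := adic_submodule x V n.+1.
  move: s sn; apply: span_ind => [|_ [s [t [sa tn ->]]]].
    split=> [|c s t sn tn]; first by rewrite scale0r; apply: (submodule0 H).
    by rewrite scalerDl -scalerA; apply: (proj2 H).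
  have [c ->] := ax sa.
  exists (fun i => c i *: ((t : R) *: y)); split=> [i|].
    apply: submoduleZ; [exact: adic_submodule|exact: IH].
  rewrite -[_ *: t]/(_ * _) mulr_suml scaler_suml; apply: eq_bigr => i _.
  by rewrite !scalerA [x i * _]mulrC.
elim: n v => [|n IH] v.
  by move=> _; rewrite -[v]scale1r; apply: mem_adic.
move=> [w [wn ->]]; apply/asboolP.
have sP : submodule (fun v : V => v \in adic_submod a V n.+1).
  by split=> [|c y z]; [apply: submod0|apply: submodP].
suff : \sum_i x i *: w i \in adic_submod a V n.+1 by move=> /asboolP.
apply: (submodule_sum _ sP) => i.
move: (IH _ (wn i)).
apply: (@span_ind _ _ _ (fun w => x i *: w \in adic_submod a V n.+1)).
  split=> [|c y z yn zn]; first by rewrite scaler0; apply: submod0.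
  by rewrite scalerDr scalerA mulrC -scalerA; apply: submodP.
move=> _ [s [y [sn _ ->]]]; rewrite scalerA; apply: mem_adic.
by apply: (mem_ideal_mul (V := R^o)).
Qed.

End AdicSubmod.

Section CompletionTheory.
Variables (R : comPzRingType) (a : ideal R).
Implicit Types V : lmodType R.

Fact to_compl_subproof V (v : V) n :
  adic_trans (quot_proj (adic_submod a V n.+1) v) = quot_proj _ v.
Proof. exact: adic_transE. Qed.
Definition to_compl V (v : V) : completion a V :=
  Completion (to_compl_subproof v).

Lemma to_complB V (v w : V) : to_compl (v - w) = to_compl v - to_compl w.
Proof. by apply: compl_eq => n; apply: (linearB (quot_proj _)). Qed.

Lemma to_complD V (v w : V) : to_compl (v + w) = to_compl v + to_compl w.
Proof. by apply: compl_eq => n; apply: (linearD (quot_proj _)). Qed.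

Lemma to_compl0 V : to_compl (0 : V) = 0.
Proof. by rewrite -(subrr 0) to_complB subrr. Qed.

Notation phi s := (to_compl (s : R^o) : compl_ring a).

Lemma to_complZ V (c : R) (v : V) : to_compl (c *: v) = phi c *: to_compl v.
Proof. by apply: compl_eq => n; rewrite /= adic_actE. Qed.

Lemma to_compl1 : phi 1 = 1. Proof. by apply: compl_eq. Qed.

Lemma compl_map_to_compl V (W : lmodType R) (f : {linear V -> W}) v :
  compl_map f (to_compl v) = to_compl (f v).
Proof. by apply: compl_eq => n; apply: adic_fmapE. Qed.

Lemma compl_valB V (c d : completion a V) n :
  compl_val (c - d) n = compl_val c n - compl_val d n.
Proof. by []. Qed.

Lemma compl_val_sum V I (s : seq I) (F : I -> completion a V) n :
  compl_val (\sum_(i <- s) F i) n = \sum_(i <- s) compl_val (F i) n.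
Proof. exact: (big_morph (fun c => compl_val c n)). Qed.

Lemma compl_val_eq0 V (v : V) n :
  compl_val (to_compl v) n = 0 <-> v \in adic_submod a V n.
Proof.
split=> [|vn].
  by rewrite -[RHS](linear0 (quot_proj _)) => /quot_projP; rewrite subr0.
by rewrite -[RHS](linear0 (quot_proj _)); apply/quot_projP; rewrite subr0.
Qed.

Lemma compl_valS V (c : completion a V) n v :
  compl_val c n.+1 = quot_proj _ v -> compl_val c n = quot_proj _ v.
Proof. by move=> cv; rewrite -(compl_valP c n) cv; apply: adic_transE. Qed.

Fact compl_series_subproof V (u : nat -> V) :
  (forall m, u m \in adic_submod a V m) -> forall n,
  adic_trans (quot_proj (adic_submod a V n.+1) (\sum_(m < n.+1) u m)) =
  quot_proj _ (\sum_(m < n) u m).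
Proof.
move=> un n; rewrite adic_transE; apply/quot_projP.
by rewrite big_ord_recr /= [_ + u n]addrC addrK.
Qed.
Definition compl_series V (u : nat -> V) uP :=
  Completion (@compl_series_subproof V u uP).

(** The terms are the differences of consecutive representatives, starting
    with the representative of level [n.+1], which vanishes modulo [a^n]. *)
Lemma compl_as_series V (c : completion a V) n : compl_val c n = 0 ->
  exists (u : nat -> V) (uP : forall m, u m \in adic_submod a V m),
    (forall m, (m < n)%N -> u m = 0) /\ c = compl_series uP.
Proof.
move=> cn; pose v m := repr (compl_val c m).
have vE m : quot_proj _ (v m) = compl_val c m by apply: quot_reprK.
pose u m := if (m < n)%N then 0 else if m == n then v m.+1 else v m.+1 - v m.
have vS m : v m.+1 - v m \in adic_submod a V m.
  by apply/quot_projP; rewrite vE; apply/esym/compl_valS/esym/vE.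
have vn m : (m <= n)%N -> compl_val c m = 0.
  elim: n cn {u} => [|k IH] ck; first by rewrite leqn0 => /eqP->.
  rewrite leq_eqVlt => /orP[/eqP->//|]; apply: IH.
  by rewrite -compl_valP ck; apply: linear0.
have uP m : u m \in adic_submod a V m.
  rewrite /u; case: ltnP => // nm; first exact: submod0.
  case: eqP => // mn; rewrite mn -[v _]subr0; apply/quot_projP.
  by rewrite linear0 -cn; apply/esym/compl_valS/esym/vE.
exists u, uP; split=> [m mn|]; first by rewrite /u mn.
apply: compl_eq => m /=; have [mn|nm] := leqP m n.
  rewrite vn // big1 ?linear0 // => -[k km] _ /=.
  by rewrite /u (leq_trans km mn).
have -> : \sum_(k < m) u k = v m; last exact/esym/vE.
elim: m nm => [//|m IH]; rewrite ltnS leq_eqVlt big_ord_recr /=.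
move=> /orP[/eqP nm|nm].
  rewrite big1 ?add0r => [|[k km] _ /=]; last by rewrite /u nm km.
  by rewrite /u -nm ltnn eqxx.
rewrite IH // /u ltnNge (ltnW nm) /= gtn_eqF //.
by rewrite addrC subrK.
Qed.

Variables (r : nat) (x : 'I_r -> R).
Hypothesis xa : forall i, (x i : R^o) \in a.
Hypothesis ax : forall s : R^o, s \in a -> exists c : 'I_r -> R,
  s = \sum_i c i * x i.
Notation xh := (fun i => phi (x i)).

(** The kernel of the projection of the completion to [V / a^n V] is [b^n]
    times the completion.  Finite generation of [a] is essential here: an
    element of the kernel is a series with terms in [a^m V], [m >= n]; writing
    each term in the [x i] and collecting the coefficients of each [x i] into
    a series lowers [n] by one. *)
Lemma compl_adicP V (c : completion a V) n :
  compl_val c n = 0 <-> adic xh n c.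
Proof.
split.
  elim: n c => [//|n IH] c /compl_as_series[u [uP [u0 ->]]].
  have /choice[w wP] m : exists w : 'I_r -> V,
      [/\ forall i, w i \in adic_submod a V m, u m.+1 = \sum_i x i *: w i &
          (m < n)%N -> forall i, w i = 0].
    (* For the vanishing terms the coordinates must be chosen to be zero, in
       order that the collected series lie in the kernel at level [n]. *)
    have [mn|nm] := ltnP m n.
      exists (fun=> 0); split=> // [i|]; first exact: submod0.
      by rewrite u0 // big1 // => i _; rewrite scaler0.
    have /(adic_submodP xa ax)[w [wm uw]] := uP m.+1.
    by exists w; split=> [i|//|//]; apply/(adic_submodP xa ax)/wm.
  have wm i m : w m i \in adic_submod a V m by case: (wP m).
  exists (fun i => compl_series (wm i)); split=> [i|].
    apply: IH => /=; rewrite big1 ?linear0 // => -[m mn] _ /=.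
    by case: (wP m) => _ _; apply.
  apply: compl_eq => k; rewrite compl_val_sum /=.
  rewrite [RHS](eq_bigr (fun i => quot_proj (adic_submod a V k)
    (x i *: \sum_(m < k) w m i))) => [|i _]; last exact: adic_actE.
  rewrite -linear_sum; apply/esym/quot_projP => /=.
  under eq_bigr do rewrite scaler_sumr.
  rewrite exchange_big /=.
  have -> : \sum_(j < k) \sum_i x i *: w j i = \sum_(m < k.+1) u m.
    rewrite big_ord_recl u0 // add0r; apply: eq_bigr => m _ /=.
    by case: (wP m).
  by rewrite big_ord_recr /= [_ + u k]addrC addrK.
elim: n c => [|n IH] c.
  move=> _; rewrite -[compl_val c 0%N]quot_reprK.
  exact/(compl_val_eq0 (V := V) _ 0)/(adic_submodP xa ax).
move=> [w [wn ->]]; rewrite compl_val_sum big1 // => i _ /=.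
rewrite -[compl_val (w i) _]quot_reprK adic_actE.
apply/(compl_val_eq0 (V := V) _ n.+1)/(adic_submodP xa ax)/adicS.
apply/(adic_submodP xa ax)/(compl_val_eq0 (V := V) _ n).
by rewrite -(IH _ (wn i)); apply/esym/compl_valS; rewrite quot_reprK.
Qed.

Lemma completion_complete V : complete xh (completion a V).
Proof.
split=> [c cn|u un].
  by apply: compl_eq => n; apply/compl_adicP/cn.
have sP n : adic_trans (\sum_(k < n.+1) compl_val (u k) n.+1) =
    \sum_(k < n) compl_val (u k) n.
  rewrite linear_sum big_ord_recr /= compl_valP.
  rewrite (proj2 (compl_adicP (u n) n) (un n)) addr0.
  by apply: eq_bigr => k _; rewrite compl_valP.
exists (Completion sP) => n; apply/compl_adicP.
by rewrite compl_valB compl_val_sum /= subrr.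
Qed.

(** The completed ring is a module over itself in two ways, as regular module
    and as completion of [R^o]; the operations agree, but the structures are
    not convertible. *)
Lemma adic_regular (c : compl_ring a) n :
  adic xh n (c : (compl_ring a)^o) <-> adic xh n (c : completion a R^o).
Proof.
elim: n c => [|n IH] c //=.
by split=> -[w [wn ->]]; exists w; split=> // i; apply/IH.
Qed.

Lemma compl_ring_complete : complete xh (compl_ring a)^o.
Proof.
have [sepC convC] := completion_complete R^o.
split=> [c cn|u un]; first by apply: sepC => n; apply/adic_regular.
have [n|s sP] := convC u; first exact/adic_regular.
by exists s => n; apply/adic_regular; apply: sP.
Qed.

Lemma compl_dense V (c : completion a V) n :
  exists v, adic xh n (c - to_compl v).
Proof.
exists (repr (compl_val c n)); apply/compl_adicP.
by rewrite compl_valB /= quot_reprK subrr.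
Qed.

Lemma to_compl_adic V (v : V) n :
  adic xh n (to_compl v) <-> v \in adic_submod a V n.
Proof.
split=> [/compl_adicP/compl_val_eq0//|/compl_val_eq0 vn].
exact/compl_adicP.
Qed.

Lemma compl_ext V (B : lmodType (compl_ring a))
    (f g : {linear completion a V -> B}) :
  separated xh B -> (forall v, f (to_compl v) = g (to_compl v)) -> f =1 g.
Proof.
move=> sepB fg c; apply/eqP; rewrite -subr_eq0; apply/eqP/sepB => n.
have [v cv] := compl_dense c n.
rewrite -[c](subrK (to_compl v)) (linearD f) (linearD g) fg.
rewrite opprD addrACA subrr addr0.
apply: submoduleB; first exact: adic_submodule; exact: adic_linear.
Qed.

(** Universal property of the completion: a map that is linear over [R] and
    takes values in a complete module extends to the completion.  The value
    at [c] is the limit of the values [h0 v] at representatives [v] of the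
    components of [c], and [G] is the graph of the extension. *)
Lemma compl_lift V (A : lmodType (compl_ring a)) (h0 : V -> A) :
  complete xh A -> (forall v w, h0 (v - w) = h0 v - h0 w) ->
  (forall c v, h0 (c *: v) = phi c *: h0 v) ->
  exists h : {linear completion a V -> A}, forall v, h (to_compl v) = h0 v.
Proof.
move=> [sepA convA] h0B h0Z.
have h00 : h0 0 = 0 by rewrite -(subrr 0) h0B subrr.
have h0D v w : h0 (v + w) = h0 v + h0 w.
  by rewrite -[w in LHS]opprK -[- w]sub0r !h0B h00 sub0r opprK.
have Asub n := adic_submodule xh A n.
have h0adic n v : v \in adic_submod a V n -> adic xh n (h0 v).
  move=> /(adic_submodP xa ax); elim: n v => [|n IH] v //= [w [wn ->]].
  exists (fun i => h0 (w i)); split=> [i|]; first exact: IH.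
  rewrite (big_morph h0 h0D h00); apply: eq_bigr => i _.
  exact: h0Z.
pose G (c : completion a V) (s : A) := forall n v,
  quot_proj _ v = compl_val c n -> adic xh n (s - h0 v).
have Guniq c s t : G c s -> G c t -> s = t.
  move=> cs ct; apply/eqP; rewrite -subr_eq0; apply/eqP/sepA => n.
  pose v := repr (compl_val c n).
  have vE : quot_proj _ v = compl_val c n by apply: quot_reprK.
  have := submoduleB (Asub n) (cs n v vE) (ct n v vE).
  by rewrite opprB addrA subrK.
have /choice[h hP] (c : completion a V) : exists s, G c s.
  pose v n := repr (compl_val c n).
  have vE n : quot_proj _ (v n) = compl_val c n by apply: quot_reprK.
  have [n|s sP] := convA (fun n => h0 (v n.+1) - h0 (v n)).
    rewrite -h0B; apply: h0adic; apply/quot_projP; rewrite vE.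
    exact/esym/compl_valS/esym/vE.
  exists (s + h0 (v 0%N)) => n w wE.
  have -> : s + h0 (v 0%N) - h0 w =
      (s - \sum_(k < n) (h0 (v k.+1) - h0 (v k))) + h0 (v n - w).
    rewrite -(big_mkord xpredT (fun k => h0 (v k.+1) - h0 (v k))).
    by rewrite telescope_sumr // h0B opprB !addrA subrK.
  apply: submoduleD; [exact: Asub|exact: sP|apply: h0adic].
  by apply/quot_projP; rewrite vE wE.
have Gto v : G (to_compl v) (h0 v).
  by move=> n w wv; rewrite -h0B; apply: h0adic; apply/quot_projP; rewrite wv.
have hl : linear h.
  move=> k c d; apply: Guniq (hP _) _ => n v vE.
  pose kn : R := repr (compl_val k n).
  pose c' := repr (compl_val c n); pose d' := repr (compl_val d n).
  have cE : quot_proj _ c' = compl_val c n by apply: quot_reprK.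
  have dE : quot_proj _ d' = compl_val d n by apply: quot_reprK.
  have kE : adic xh n ((k - phi kn : compl_ring a) : (compl_ring a)^o).
    apply/adic_regular/(compl_adicP (V := R^o)).
    by rewrite compl_valB /= quot_reprK subrr.
  (* The difference is split into four parts, each of which is small: the
     error of [kn] as approximation of the scalar [k], the errors of [c'] and
     [d'] as approximations, and the image of an element of [a^n V]. *)
  have zmod_id (y1 y2 y3 z1 z2 w : A) :
      y1 - y2 + (y2 - y3) + (z1 - z2) + (y3 + z2 - w) = y1 + z1 - w.
    by rewrite [y1 - y2 + _]addrA subrK [y1 - y3 + _]addrACA -opprD addrA subrK.
  rewrite -(zmod_id _ (phi kn *: h c) (phi kn *: h0 c') _ (h0 d')).
  rewrite -scalerBl -scalerBr -h0Z -h0D -h0B.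
  apply: (submoduleD (Asub n)); last first.
    apply: h0adic; apply/quot_projP; rewrite linearD linearZ /= cE dE vE /=.
    by rewrite -[compl_val k n]quot_reprK -cE adic_actE linearZ /= cE.
  apply: (submoduleD (Asub n)); last exact: (hP d n d' dE).
  apply: (submoduleD (Asub n)); last first.
    by apply: submoduleZ; [exact: Asub|exact: (hP c n c' cE)].
  exact: (adic_linear (scale_at (h c)) kE).
by exists (mk_linear hl) => v; apply: Guniq (hP _) (Gto v).
Qed.

End CompletionTheory.

(** Restriction of scalars from the completed ring to [R], under a new name
    for the carrier so that both module structures can coexist. *)
Section Restriction.
Variables (R : comPzRingType) (a : ideal R) (A : lmodType (compl_ring a)).

Definition restriction : Type := A.
HB.instance Definition _ := GRing.Zmodule.on restriction.
Definition restr_scale (c : R) (v : restriction) : restriction :=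
  (to_compl a (c : R^o) : compl_ring a) *: (v : A).

Fact restr_scaleA c d v :
  restr_scale c (restr_scale d v) = restr_scale (c * d) v.
Proof.
rewrite /restr_scale scalerA; congr (_ *: _).
exact/esym/(to_complZ a c (d : R^o)).
Qed.
Fact restr_scale1 : left_id 1 restr_scale.
Proof. by move=> v; rewrite /restr_scale to_compl1 scale1r. Qed.
Fact restr_scaleDr : right_distributive restr_scale +%R.
Proof. by move=> c v w; apply: scalerDr. Qed.
Fact restr_scaleDl v : {morph restr_scale^~ v : c d / c + d}.
Proof.
by move=> c d; rewrite /restr_scale (to_complD a (c : R^o)) scalerDl.
Qed.
HB.instance Definition _ := GRing.Zmodule_isLmodule.Build R restriction
  restr_scaleA restr_scale1 restr_scaleDr restr_scaleDl.

End Restriction.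

(** Lift the images of the basis, and extend first to the free module and then
    to its completion. *)
Lemma cproj_completion_free (R : comPzRingType) (a : ideal R) (r : nat)
    (x : 'I_r -> R) (X : choiceType) :
  (forall i, (x i : R^o) \in a) ->
  (forall s : R^o, s \in a -> exists c : 'I_r -> R, s = \sum_i c i * x i) ->
  complete_projective (fun i => to_compl a (x i : R^o) : compl_ring a)
    (completion a (freem R X)).
Proof.
move=> xa ax; split; first exact: completion_complete.
move=> A B g f compA [sepB convB] surj.
have /choice[al alP] (e : X) :
    exists v, g v = f (to_compl a (free_gen R e)) by apply: surj.
pose h0 : {linear freem R X -> restriction A} :=
  free_lift (al : X -> restriction A).
have [h hP] : exists h : {linear completion a (freem R X) -> A},
    forall v, h (to_compl a v) = h0 v.
  apply: (compl_lift xa ax (h0 := h0)) => // [v w|c v].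
    exact: (linearB h0).
  exact: (linearZ_LR h0).
exists h; apply: (compl_ext xa ax (f := g \o h)) => // v.
rewrite /= hP.
have gl : linear (fun v => g (h0 v) : restriction B).
  move=> c u w; rewrite /= (linearP h0) (linearD g); congr (_ + _).
  exact: (linearZ_LR g).
have fl : linear (fun v => f (to_compl a v) : restriction B).
  move=> c u w; rewrite to_complD to_complZ (linearD f); congr (_ + _).
  exact: (linearZ_LR f).
apply: (free_ext (f := mk_linear gl) (g := mk_linear fl)) => e /=.
by rewrite /h0 free_lift_gen alP.
Qed.

(** * Tensor product with the residue ring *)

Section TensorQuotient.
Variables (R : comPzRingType) (a : ideal R).

(** The map from [V] to [R/a (x) V] sending [v] to [1 (x) v]; it is onto with
    kernel [aV], which identifies [R/a (x) V] with [V / aV]. *)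
Definition tensor1 (V : lmodType R) (v : V) : tensor (quotm a) V :=
  quot_proj _ (free_gen R (quot_proj a (1 : R), v)).

Lemma tensor_relP (V : lmodType R) (u v : freem R (quotm a * V)%type) :
  tensor_rels (u - v) ->
  quot_proj (Defs.span (@tensor_rels R (quotm a) V)) u = quot_proj _ v.
Proof. by move=> uv; apply/quot_projP/mem_span. Qed.

Lemma tensorZl (V : lmodType R) c (q : quotm a) (v : V) :
  quot_proj (Defs.span (@tensor_rels R (quotm a) V)) (free_gen R (c *: q, v)) =
  c *: quot_proj _ (free_gen R (q, v)).
Proof.
by rewrite -linearZ; apply: tensor_relP; constructor 3; exists c, q, v.
Qed.

Lemma tensor1D (V : lmodType R) (v w : V) :
  tensor1 (v + w) = tensor1 v + tensor1 w.
Proof.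
rewrite /tensor1 -linearD; apply: tensor_relP; constructor 2.
by exists (quot_proj a (1 : R)), v, w.
Qed.

Lemma tensor1Z (V : lmodType R) c (v : V) : tensor1 (c *: v) = c *: tensor1 v.
Proof.
rewrite /tensor1 -linearZ; apply: tensor_relP; constructor 4.
by exists c, (quot_proj a (1 : R)), v.
Qed.

Fact tensor1_linear (V : lmodType R) : linear (@tensor1 V).
Proof. by move=> c v w; rewrite tensor1D tensor1Z. Qed.
HB.instance Definition _ (V : lmodType R) :=
  GRing.isLinear.Build R V (tensor (quotm a) V) *:%R (@tensor1 V)
    (@tensor1_linear V).

Lemma tensor1_surj (V : lmodType R) (t : tensor (quotm a) V) :
  exists v, t = tensor1 v.
Proof.
rewrite -[t]quot_reprK -[repr t]free_liftK /free_lift linear_sum.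
have P : submodule (fun t : tensor (quotm a) V => exists v, t = tensor1 v).
  split=> [|c _ _ [v ->] [w ->]]; first by exists 0; rewrite linear0.
  by exists (c *: v + w); rewrite linearP.
elim/big_rec: _ => [|[q v] s _ IH]; first exact: (submodule0 P).
apply: (submoduleD P) => //; rewrite linearZ; apply: (submoduleZ _ P).
exists ((repr q : R) *: v); rewrite tensor1Z /tensor1 -tensorZl.
congr (quot_proj _ (free_gen R (_, v))).
rewrite -linearZ -[LHS]quot_reprK; congr quot_proj.
exact/esym/mulr1.
Qed.

Lemma ideal_pow1 (s : R^o) : s \in ideal_pow a 1 <-> s \in a.
Proof.
split=> [|sa]; last first.
  by rewrite -[s]mulr1; apply: (mem_ideal_mul (V := R^o)).
apply: (@span_ind _ _ _ (fun s : R^o => s \in a)) => [|_ [c [d [ca _ ->]]]].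
  by split=> [|c u v]; [apply: submod0|apply: submodP].
by rewrite [_ *: _]mulrC -[_ * _]addr0; apply: submodP => //; apply: submod0.
Qed.

(** Sending [q (x) v] to [r v], where [r] is a representative of [q], is well
    defined modulo [aV]. *)
Lemma tensor1_eq0 (V : lmodType R) (v : V) :
  tensor1 v = 0 <-> v \in adic_submod a V 1.
Proof.
split=> [|].
  pose h : {linear freem R (quotm a * V)%type -> V} :=
    free_lift (fun p : quotm a * V => (repr p.1 : R) *: p.2).
  have hE p : h (free_gen R p) = (repr p.1 : R) *: p.2 by apply: free_lift_gen.
  have adicZ (s : R^o) (w : V) : s \in a -> (s : R) *: w \in adic_submod a V 1.
    by move=> sa; apply: mem_adic; apply/ideal_pow1.
  have reprE (s : R^o) : repr (quot_proj a s) - s \in a := quot_reprP a s.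
  have hrel u : tensor_rels u -> h u \in adic_submod a V 1.
    case=> [[p [q [w ->]]]|[q [w [w' ->]]]|[c [q [w ->]]]|[c [q [w ->]]]].
    - rewrite linearB linearD !hE /= -scalerDl -scalerBl; apply: adicZ.
      by apply/quot_projP; rewrite linearD /= !quot_reprK.
    - by rewrite linearB linearD !hE /= scalerDr subrr; apply: submod0.
    - rewrite linearB linearZ !hE /= scalerA -scalerBl; apply: adicZ.
      by apply/(quot_projP a _ (c *: repr q)); rewrite linearZ /= !quot_reprK.
    - rewrite linearB linearZ !hE /= !scalerA mulrC subrr; exact: submod0.
  rewrite -[RHS](linear0 (quot_proj _)) => /quot_projP; rewrite subr0 => vrel.
  have : h (free_gen R (quot_proj a (1 : R), v)) \in adic_submod a V 1.
    apply: (@span_ind _ _ _ (fun u => h u \in adic_submod a V 1)) hrel _ vrel.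
    split=> [|c u w uP wP]; first by rewrite linear0; apply: submod0.
    by rewrite linearP; apply: submodP.
  rewrite hE /= => v2.
  have := adicZ _ v (reprE (1 : R)); rewrite scalerBl scale1r => v1.
  rewrite -[v](subKr ((repr (quot_proj a (1 : R)) : R) *: v)).
  exact: submodB.
apply: (@span_ind _ _ _ (fun v => tensor1 v = 0)) =>
  [|_ [s [w [/ideal_pow1 sa _ ->]]]].
  split=> [|c u w u0 w0]; first exact: linear0.
  by rewrite tensor1D tensor1Z u0 w0 scaler0 addr0.
rewrite tensor1Z /tensor1 -tensorZl.
have -> : s *: quot_proj a (1 : R) = (0 : R) *: quot_proj a (1 : R).
  rewrite -!linearZ; apply/quot_projP.
  by rewrite scale0r subr0 [_ *: _]mulr1.
by rewrite tensorZl scale0r.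
Qed.

End TensorQuotient.

(** * Local homology and Tor *)

Section MainTheorem.
Variables (R : comPzRingType) (a : ideal R) (M : lmodType R).
Hypothesis noethR : noetherian R.

Lemma Tor_fg n : finitely_generated (Tor n (quotm a) M) <->
  fg_homology (fun n (v : free_complex M n) => v \in adic_submod a _ 1) n.
Proof.
rewrite /Tor /left_derived homology_fg.
pose T := fcomplex (tensor_functor (quotm a)) (free_complex M).
have E (V : lmodType R) (v : V) t :
    t = tensor1 a v -> v \in adic_submod a V 1 <-> t = 0.
  by move=> ->; rewrite tensor1_eq0.
have tmap (V W : lmodType R) (f : {linear V -> W}) v :
    tensor_map f (tensor1 a v) = tensor1 a (f v).
  by rewrite /tensor1 tensor_mapE tensor_preE.
split.
- apply: (fg_homology_transfer (A := T) (B := free_complex M)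
    (Phi := fun n t v => t = tensor1 a v)).
  + by move=> k; rewrite linear0.
  + by move=> k t v t' v' -> ->; rewrite linearB.
  + by move=> c; exists c => k t v ->; rewrite linearZ.
  + by move=> k t; apply: tensor1_surj.
  + by move=> k v; exists (tensor1 a v).
  + by move=> k t v ->; apply: tmap.
  + by move=> k t v tv; apply: iff_sym; apply: E; exact: tv.
- apply: (fg_homology_transfer (A := free_complex M) (B := T)
    (Phi := fun n v t => t = tensor1 a v)).
  + by move=> k; rewrite linear0.
  + by move=> k v t v' t' -> ->; rewrite linearB.
  + by move=> c; exists c => k v t ->; rewrite linearZ.
  + by move=> k v; exists (tensor1 a v).
  + by move=> k t; apply: tensor1_surj.
  + by move=> k v t ->; apply: tmap.
  + by move=> k v t; apply: E.
Qed.

Variables (r : nat) (x : 'I_r -> R).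
Hypothesis xa : forall i, (x i : R^o) \in a.
Hypothesis ax : forall s : R^o, s \in a -> exists c : 'I_r -> R,
  s = \sum_i c i * x i.
Notation phi s := (to_compl a (s : R^o) : compl_ring a).
Notation xh := (fun i => phi (x i)).

(** The completion modulo [b] is [P / aP], and scalars of the completed ring
    may be replaced modulo [b] by scalars of [R]. *)
Lemma completion_fg n :
  fg_homology (fun n (v : free_complex M n) => v \in adic_submod a _ 1) n <->
  fg_homology (fun n (v : fcomplex (completion_functor a) (free_complex M) n) =>
    adic xh 1 v) n.
Proof.
pose Phi k (v : free_complex M k) (c : completion a (free_complex M k)) :=
  adic xh 1 (c - to_compl a v).
pose C := fcomplex (completion_functor a) (free_complex M).
have Asub k := adic_submodule xh (completion a (free_complex M k)) 1.
have Phi0 k : Phi k 0 0.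
  by rewrite /Phi to_compl0 subr0; apply: (submodule0 (Asub k)).
have PhiB k v c w d : Phi k v c -> Phi k w d -> Phi k (v - w) (c - d).
  rewrite /Phi to_complB => vc wd.
  have -> : c - d - (to_compl a v - to_compl a w) =
      (c - to_compl a v) - (d - to_compl a w).
    by rewrite !opprB addrACA [in RHS]addrACA [- d + _]addrC.
  exact: (submoduleB (Asub k)).
have PhiR k v : Phi k v (to_compl a v).
  by rewrite /Phi subrr; apply: (submodule0 (Asub k)).
have Phid k v c : Phi k.+1 v c ->
    Phi k (cdiff (free_complex M) k v) (compl_map (cdiff (free_complex M) k) c).
  move=> vc; rewrite /Phi -compl_map_to_compl.
  rewrite -(linearB (compl_map (cdiff (free_complex M) k))).
  exact: (adic_linear (compl_map (cdiff (free_complex M) k))).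
have PhiI k v c : Phi k v c -> v \in adic_submod a _ 1 <-> adic xh 1 c.
  move=> vc; rewrite -(to_compl_adic xa ax); split=> [v1|c1].
    by rewrite -[c](subrK (to_compl a v)); apply: (submoduleD (Asub k)).
  by rewrite -[to_compl a v](subKr c); apply: (submoduleB (Asub k)).
have Phidense k c : exists v, Phi k v c by apply: compl_dense.
split.
- apply: (fg_homology_transfer (A := free_complex M) (B := C)
    (Phi := Phi)) => //.
    move=> c; exists (phi c) => k v d vd.
    rewrite /Phi to_complZ -scalerBr; exact: (submoduleZ _ (Asub k)).
  by move=> k v; exists (to_compl a v).
- apply: (fg_homology_transfer (A := C) (B := free_complex M)
    (Phi := fun k c v => Phi k v c)) => //.
  + by move=> k c v d w; apply: PhiB.
  + move=> c; have [c' cc'] := compl_dense xa ax (c : completion a R^o) 1.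
    exists c' => k d v vd; rewrite /Phi to_complZ.
    have -> : c *: d - phi c' *: to_compl a v =
        (c - phi c') *: d + phi c' *: (d - to_compl a v).
      by rewrite scalerBl scalerBr addrA subrK.
    apply: (submoduleD (Asub k)); last exact: (submoduleZ _ (Asub k)).
    by apply: (adic_linear (scale_at d)); apply/(adic_regular x).
  + by move=> k v; exists (to_compl a v).
  + by move=> k c v; apply: Phid.
  + by move=> k c v cv; apply: iff_sym; apply: PhiI.
Qed.

Lemma cproj_free_complex k :
  complete_projective xh (fcomplex (completion_functor a) (free_complex M) k).
Proof. by case: k => [|k]; apply: cproj_completion_free. Qed.

(** An ideal that contains all the [xh i] is generated by them together with
    the generators of its inverse image in [R]. *)
Lemma compl_ring_noetherian : noetherian (compl_ring a).
Proof.
apply: (complete_noetherian (compl_ring_complete xa ax)) => N NP Nx.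
have Asub := adic_submodule xh ((compl_ring a)^o) 1.
apply: (fg_ext (K1 := fun c => adic xh 1 c)) => //.
  have : fg_mod (fun s : R^o => N (phi s)) (fun s => s = 0).
    apply: noetherian_fg_ideal => //; split=> [|c s t Ns Nt].
      by rewrite to_compl0; apply: (submodule0 NP).
    by rewrite to_complD to_complZ; apply: (proj2 NP).
  apply: (fg_transfer (Phi := fun (s : R^o) (c : (compl_ring a)^o) =>
    adic xh 1 (c - phi s))).
  - by rewrite to_compl0 subr0; apply: (submodule0 Asub).
  - move=> s c t d sc td; rewrite to_complB.
    have -> : c - d - (phi s - phi t) = (c - phi s) - (d - phi t).
      by rewrite !opprB addrACA [in RHS]addrACA [- d + _]addrC.
    exact: submoduleB.
  - move=> e; exists (phi e) => s c sc; rewrite to_complZ.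
    by rewrite -(scalerBr (phi e) c); apply: submoduleZ.
  - move=> s Ns; exists (phi s); split=> //.
    by rewrite subrr; apply: (submodule0 Asub).
  - move=> c Nc; have [s cs] := compl_dense xa ax (c : completion a R^o) 1.
    have {}cs : adic xh 1 ((c - phi s : compl_ring a) : (compl_ring a)^o).
      by apply/(adic_regular x).
    exists s; split=> //; rewrite -[phi s](subKr c).
    apply: submoduleB => //; have [w [_ ->]] := cs.
    apply: submodule_sum => // i; rewrite [_ *: _]mulrC.
    exact: (submoduleZ (w i) NP).
  - by move=> s c sc s0; rewrite s0 to_compl0 subr0 in sc.
exists [seq (xh i : (compl_ring a)^o) | i <- index_enum 'I_r]; split=> [g|c].
  move=> /mapP[i _ ->]; split=> //.
  have -> : (xh i : (compl_ring a)^o) = xh i *: (1 : (compl_ring a)^o).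
    exact/esym/(mulr1 (phi (x i))).
  exact: adicS.
move=> [_ [w [_ ->]]].
have -> : \sum_i xh i *: w i =
    \sum_i (w i : compl_ring a) *: (xh i : (compl_ring a)^o).
  by apply: eq_bigr => i _; apply: mulrC.
exact: gen_sum.
Qed.

Lemma local_homology_Tor_fg n :
  (forall i, (i <= n)%N -> finitely_generated (local_homology a i M)) <->
  (forall i, (i <= n)%N -> finitely_generated (Tor i (quotm a) M)).
Proof.
have H := fg_homology_mod (compl_ring_complete xa ax) compl_ring_noetherian n
  cproj_free_complex.
split=> fgH i lei.
- apply/Tor_fg/completion_fg; move: i lei; apply/H => i lei.
  exact/homology_fg/fgH.
- apply/homology_fg; move: i lei; apply/H => i lei.
  exact/completion_fg/Tor_fg/fgH.
Qed.

End MainTheorem.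

Theorem theorem1p2 (R : comPzRingType) (a : ideal R) (M : lmodType R) :
  noetherian R ->
  ((forall i : nat, finitely_generated (local_homology a i M)) <->
   (forall i : nat, finitely_generated (Tor i (quotm a) M))) /\
  ((forall i : nat, finitely_generated (Tor i (quotm a) M)) <->
   (forall i : nat, ((Posz i)%:E <= hdim a M)%E ->
      finitely_generated (Tor i (quotm a) M))).
Proof.
move=> noethR; have [r [g gP]] := noethR a.
pose x i : R := submod_val (g i).
have xa i : (x i : R^o) \in a by apply: submod_valP.
have ax (s : R^o) : s \in a -> exists c : 'I_r -> R, s = \sum_i c i * x i.
  move=> sa; have [c /(congr1 (@submod_val _ _ _)) /= sE] := gP (Submod sa).
  exists c; rewrite sE.
  by apply: (big_morph (@submod_val _ _ _)).
have main := local_homology_Tor_fg M noethR xa ax.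
have main12 : (forall i, finitely_generated (local_homology a i M)) <->
    (forall i, finitely_generated (Tor i (quotm a) M)).
  split=> fgH i; first by apply: (proj1 (main i)) (leqnn i) => j _.
  by apply: (proj2 (main i)) (leqnn i) => j _.
split=> //; split=> [//|fgT]; apply/main12 => i.
have [ihd|ihd] := pselect ((Posz i)%:E <= hdim a M)%E.
  apply: (proj2 (main i)) (leqnn i) => j ji; apply: fgT.
  by have /le_hdim[k [ik kP]] := ihd; apply/le_hdim; exists k; split=> //;
    apply: leq_trans ik.
(* Above the homological dimension the local homology vanishes. *)
exists 0%N, (fun=> 0) => v; exists (fun=> 0); rewrite big_ord0.
apply/eqP; apply: contraPT isT => v0 _; apply: ihd.
by apply/le_hdim; exists i; split=> //; exists v.
Qed.
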